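(* Let $\kappa^1,\kappa^2$ be skew diagrams with $|\kappa^1|=|\kappa^2|=N$, and let $\lambda^i\subset\nu^i$ ($i=1,2$) be Young diagrams with $\kappa^i=\nu^i\setminus\lambda^i$. Let $\mathcal S=\mathcal S_3\circ\mathcal S_2\circ\mathcal S_1$ and $\mathcal C=\mathcal C_1\circ\mathcal C_2\circ\mathcal C_3$ be the maps constructed in the context. Then $$\mathcal S:\mathbf P(\kappa^1,\kappa^2)\to\coprod_{\mu}\left(\mathbf B(\mu)^{\nu^1}_{\lambda^1}\times\mathbf B(\mu)^{\nu^2}_{\lambda^2}\right)\quad\text{and}\quad \mathcal C:\coprod_{\mu}\left(\mathbf B(\mu)^{\nu^1}_{\lambda^1}\times\mathbf B(\mu)^{\nu^2}_{\lambda^2}\right)\to\mathbf P(\kappa^1,\kappa^2),$$ where $\mu$ runs over the Young diagrams with $|\mu|=N$, are both well-defined bijections, and they are inverse to each other.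
   Context: Diagrams and tableaux. Boxes of (skew) Young diagrams are identified with points $(i,j)\in\mathbb N\times\mathbb N$ ($i$ = row, counted from the top; $j$ = column, counted from the left). A skew diagram $\kappa=\nu\setminus\lambda$ ($\lambda\subset\nu$ Young diagrams) is the set-theoretic difference; $|\kappa|$ is its number of boxes and $\kappa_i=\nu_i-\lambda_i$ its number of boxes in row $i$. Fix $n$ such that all given Young diagrams have at most $n$ rows. (Skew) Young tableaux are semistandard (rows weakly increasing left to right, columns strictly increasing downwards) with entries in $\{1,\dots,n+1\}$; $S_{i,j}$ is the entry of $S$ in box $(i,j)$. $\mathbf B(\mu)$ is the set of Young tableaux of shape $\mu$. Pictures. On subsets of $\mathbb N\times\mathbb N$: $(a,b)\leqslant_P(c,d)$ iff $a\le c$ and $b\le d$; $(a,b)\leqslant_J(c,d)$ iff $a<c$, or $a=c$ and $b\ge d$. A map $f:X\to Y$ is PJ-standard if $x\leqslant_P x'$ implies $f(x)\leqslant_J f(x')$. A picture is a bijection $f$ such that $f$ and $f^{-1}$ are PJ-standard. $\mathbf P(\kappa^1,\kappa^2)$ is the set of pictures $\kappa^1\to\kappa^2$. Reading and additions. The middle-eastern reading $ME(S)=i_1\otimes\cdots\otimes i_N$ of a (skew) tableau $S$ lists its entries row by row from top to bottom, each row read from right to left. For a Young diagram $\lambda$, $\lambda[i]$ is obtained from $\lambda$ by increasing $\lambda_i$ by 1 (possibly not a Young diagram), and $\lambda[i_1,\dots,i_k]=(\cdots(\lambda[i_1])\cdots)[i_k]$. Littlewood-Richardson crystal. $\mathbf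 B(\mu)^\nu_\lambda$ is the set of $T\in\mathbf B(\mu)$ such that, writing $ME(T)=i_1\otimes\cdots\otimes i_N$, $\lambda[i_1,\dots,i_k]$ is a Young diagram for every $k=1,\dots,N$ and $\lambda[i_1,\dots,i_N]=\nu$. Column bumping $x\to T$. If all entries of the first column of $T$ are smaller than $x$, put $x$ at the bottom of that column and stop. Otherwise let $y$ be the topmost entry of that column with $y\ge x$; replace $y$ by $x$, and insert $y$ in the same way into the second column, and so on; if one passes the last column, create a new column consisting of the bumped entry. The shape grows by one box, the new box $\mathrm{New}(x)$. The procedure is reversible given the new box (reverse column bumping). For a two-rowed array $w=\binom{w^1}{w^2}=\binom{b_1\cdots b_N}{a_1\cdots a_N}$, the column bumping of $w^2$ is $T^2=a_N\to(\cdots(a_2\to a_1))$, and the recording tableau by $w^1$ is the filling of the same shape with $b_k$ in the box $\mathrm{New}(a_k)$. The array $w$ is lexicographic (of column type) if $b_1\le\cdots\le b_N$ and $b_k=b_{k+1}$ implies $a_k\ge a_{k+1}$. Intermediate sets. $\mathbf S(\kappa^1,\kappa^2)$ is the set of skew tableaux $S$ of shape $\kappa^1$ in which the number of entries equal to $i$ is $\kappa^2_i$ for all $i$, and such that, writing $ME(S)=i_1\otimes\cdots\otimes i_N$, $\lambda^2[i_1,\dots,i_k]$ is a Young diagram for $k=1,\dots,N$ and $\lambda^2[i_1,\dots,i_N]=\nu^2$. $\mathbf W(\kappa^1,\kappa^2)$ is the set of lexicographic two-rowed arrays $w=\binom{w^1}{w^2}$ of length $N$ in which $i$ occurs $\kappa^j_i$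 times in $w^j$ ($j=1,2$), and such that for some Young diagram $\mu$ the column bumping of $w^2$ is in $\mathbf B(\mu)^{\nu^2}_{\lambda^2}$ and the recording tableau by $w^1$ is in $\mathbf B(\mu)^{\nu^1}_{\lambda^1}$. Maps. - $\mathcal S_1:\mathbf P(\kappa^1,\kappa^2)\to\mathbf S(\kappa^1,\kappa^2)$: for $f=(f_1,f_2)$ (row and column coordinates), $\mathcal S_1(f)$ is the filling $S$ of $\kappa^1$ with $S_{i,j}=f_1(i,j)$. - $\mathcal S_2:\mathbf S(\kappa^1,\kappa^2)\to\mathbf W(\kappa^1,\kappa^2)$: if $ME(S)=a_1\otimes\cdots\otimes a_N$ and $b_i$ is the row number of the box of $S$ containing (this occurrence of) $a_i$, then $\mathcal S_2(S)=\binom{b_1\cdots b_N}{a_1\cdots a_N}$. - $\mathcal S_3:\mathbf W(\kappa^1,\kappa^2)\to\coprod_\mu(\mathbf B(\mu)^{\nu^1}_{\lambda^1}\times\mathbf B(\mu)^{\nu^2}_{\lambda^2})$: $\mathcal S_3(w)=(T^1,T^2)$ with $T^2$ the column bumping of $w^2$ and $T^1$ the recording tableau by $w^1$. - $\mathcal C_3$ (opposite direction to $\mathcal S_3$): given $(T^1,T^2)$, repeatedly take the box of $T^1$ containing the right-most occurrence of its maximal entry, apply reverse column bumping to $T^2$ starting from the box in the same position, and remove that box from $T^1$; if $c_{N+1-i}$ is the $i$-th entry bumped out of $T^2$ and $d_{N+1-i}$ the $i$-th entry removed from $T^1$, then $\mathcal C_3(T^1,T^2)=\binom{d_1\cdots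 d_N}{c_1\cdots c_N}$. - $\mathcal C_2:\mathbf W(\kappa^1,\kappa^2)\to\mathbf S(\kappa^1,\kappa^2)$: for $w=\binom{d_1\cdots d_N}{c_1\cdots c_N}$, $\mathcal C_2(w)$ is the filling of $\kappa^1$ obtained by placing $c_1,\dots,c_N$ into the boxes of $\kappa^1$ in the middle-eastern order (rows top to bottom, each from right to left). - $\mathcal C_1:\mathbf S(\kappa^1,\kappa^2)\to\mathbf P(\kappa^1,\kappa^2)$: $\mathcal C_1(S)=f$ with $f(i,j)=(S_{i,j},\lambda^2_{S_{i,j}}+p(S;i,j))$, where, with $k=S_{i,j}$, $p(S;i,j)$ is the position of $(i,j)$ counted from the right (starting at 1) among the boxes of $S$ with entry $k$ (these lie in distinct columns). ''Well-defined'' means that the images of these maps lie in the stated target sets. *)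

(* Defs.v *)
From mathcomp Require Import all_boot.
From mathcomp Require Import classical_sets functions.

Set Implicit Arguments.
Unset Strict Implicit.
Unset Printing Implicit Defensive.

Local Open Scope classical_set_scope.

(* (row, column); rows and columns are numbered from 1. *)
Definition box := (nat * nat)%type.

(* A Young diagram is given by its nonzero row lengths; since zero rows are   *)
(* not recorded, equal diagrams are equal sequences.                          *)
Definition young (l : seq nat) : bool := sorted geq l && (0 \notin l).

Definition rowlen (l : seq nat) (i : nat) : nat := nth 0 l i.-1.

(* The boxes of nu \ lam, listed in the middle-eastern order. *)
Definition skew (lam nu : seq nat) : seq box :=
  [seq (i, j) | i <- iota 1 (size nu),
                j <- rev (iota (rowlen lam i).+1 (rowlen nu i - rowlen lam i))].

Definition diagram (mu : seq nat) : seq box := skew [::] mu.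

Lemma mem_skew lam nu (i j : nat) :
  ((i, j) \in skew lam nu) = (0 < i) && (rowlen lam i < j <= rowlen nu i).
Proof.
have memr l m : (j \in rev (iota l.+1 (m - l))) = (l < j <= m).
  rewrite mem_rev mem_iota addSn ltnS.
  case: (leqP l m) => [lm|ml]; first by rewrite subnKC.
  have /eqP -> : m - l == 0 by rewrite subn_eq0 ltnW.
  rewrite addn0; have -> : (l < j) && (j <= l) = false by case: ltngtP.
  apply/esym/negbTE/negP => /andP[/ltnW lj jm].
  by have := leq_ltn_trans (leq_trans lj jm) ml; rewrite ltnn.
apply/allpairsPdep/idP => [[i' [j' [Hi Hj [-> ej]]]]|/andP[i0 Hj]].
  move: Hi Hj; rewrite -ej memr mem_iota => /andP[-> _] -> //.
exists i, j; rewrite memr Hj mem_iota i0 add1n ltnS; split=> //.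
rewrite leqNgt; apply/negP => lt; move: Hj.
rewrite /rowlen [nth 0 nu _]nth_default; last by case: i i0 lt.
by rewrite leqn0 => /andP[+ /eqP j0]; rewrite j0.
Qed.

Lemma skew_uniq lam nu : uniq (skew lam nu).
Proof.
apply: allpairs_uniq_dep => [|i _|[i j] [i' j'] _ _ /= [-> ->] //].
  exact: iota_uniq.
by rewrite rev_uniq iota_uniq.
Qed.

Definition le_P (x y : box) : bool := (x.1 <= y.1) && (x.2 <= y.2).

Definition le_J (x y : box) : bool :=
  (x.1 < y.1) || (x.1 == y.1) && (y.2 <= x.2).

Definition PJ_standard (X Y : seq box) (f : seq_sub X -> seq_sub Y) : Prop :=
  forall x x', le_P (val x) (val x') -> le_J (val (f x)) (val (f x')).

(* P(X, Y), the pictures being recorded with values in all of N x N. *)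
Definition pictures (X Y : seq box) : set {ffun seq_sub X -> box} :=
  [set f | exists (g : seq_sub X -> seq_sub Y) (h : seq_sub Y -> seq_sub X),
     [/\ forall x, f x = val (g x), cancel g h, cancel h g,
         PJ_standard g & PJ_standard h]].

(* lam[i]: outside the Young diagrams the result may have interior zeros. *)
Definition add_box (lam : seq nat) (i : nat) : seq nat := incr_nth lam i.-1.

Definition add_boxes (lam : seq nat) (w : seq nat) : seq nat :=
  foldl add_box lam w.

Definition adds_to (lam nu : seq nat) (w : seq nat) : Prop :=
  (forall k, 1 <= k <= size w -> young (add_boxes lam (take k w))) /\
  add_boxes lam w = nu.

(* F b is the entry in the box b of D; its values outside D are irrelevant. *)
Definition semistandard (n : nat) (D : seq box) (F : box -> nat) : Prop :=
  [/\ {in D, forall b, 1 <= F b <= n.+1},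
      {in D &, forall b c, b.1 = c.1 -> b.2 <= c.2 -> F b <= F c}
    & {in D &, forall b c, b.2 = c.2 -> b.1 < c.1 -> F b < F c}].

(* The middle-eastern reading of the filling F of nu \ lam. *)
Definition ME (lam nu : seq nat) (F : box -> nat) : seq nat :=
  map F (skew lam nu).

(* Tableaux of straight shape are given by their columns, from left to right, *)
(* each column being read from top to bottom.                                 *)
Definition columns := seq (seq nat).

Definition entry (T : columns) (b : box) : nat :=
  nth 0 (nth [::] T b.2.-1) b.1.-1.

Definition conj_shape (s : seq nat) : seq nat :=
  [seq count (leq j) s | j <- iota 1 (head 0 s)].

Definition row_shape (T : columns) : seq nat := conj_shape (map size T).

(* B(mu) *)
Definition tableaux (n : nat) (mu : seq nat) : set columns :=
  [set T | map size T = conj_shape mu /\ semistandard n (diagram mu) (entry T)].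

(* B(mu)^nu_lam *)
Definition LR_crystal (n : nat) (mu lam nu : seq nat) : set columns :=
  [set T | tableaux n mu T /\ adds_to lam nu (ME [::] mu (entry T))].

(* The disjoint union over mu is made of triples (mu, T1, T2). *)
Definition LR_pairs (n N : nat) (lam1 nu1 lam2 nu2 : seq nat) :
    set (seq nat * columns * columns) :=
  [set t | [/\ young t.1.1, sumn t.1.1 = N,
               LR_crystal n t.1.1 lam1 nu1 t.1.2
             & LR_crystal n t.1.1 lam2 nu2 t.2]].

(* When no entry of c is >= x, find gives size c, and set_nth then puts x at  *)
(* the bottom of c.                                                           *)
Fixpoint col_bump (x : nat) (T : columns) : columns :=
  match T with
  | [::] => [:: [:: x]]
  | c :: T' =>
      let k := find (leq x) c in
      set_nth 0 c k x :: (if k < size c then col_bump (nth 0 c k) T' else T')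
  end.

Fixpoint new_box (x : nat) (T : columns) : box :=
  match T with
  | [::] => (1, 1)
  | c :: T' =>
      let k := find (leq x) c in
      if k < size c then
        let b := new_box (nth 0 c k) T' in (b.1, b.2.+1)
      else ((size c).+1, 1)
  end.

Definition set_entry (T : columns) (b : box) (x : nat) : columns :=
  set_nth [::] T b.2.-1 (set_nth 0 (nth [::] T b.2.-1) b.1.-1 x).

(* A two-rowed array is the sequence of its columns (b_k, a_k). *)
Definition array := seq (nat * nat).

Definition bumping_step (st : columns * columns) (p : nat * nat) :
    columns * columns :=
  (set_entry st.1 (new_box p.2 st.2) p.1, col_bump p.2 st.2).

(* (recording tableau by w^1, column bumping of w^2) *)
Definition bumping (w : array) : columns * columns :=
  foldl bumping_step ([::], [::]) w.

Definition lexicographic (w : array) : Prop :=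
  forall k, k.+1 < size w ->
    let p := nth (0, 0) w k in let q := nth (0, 0) w k.+1 in
    p.1 <= q.1 /\ (p.1 = q.1 -> q.2 <= p.2).

(* Meant for a corner b of T; a column that becomes empty disappears. *)
Definition del_box (T : columns) (b : box) : columns :=
  [seq c <- set_nth [::] T b.2.-1 (take b.1.-1 (nth [::] T b.2.-1))
     | c != [::]].

(* y moves through the columns cs from right to left; in each of them it      *)
(* replaces the bottommost entry that is <= y, which moves on. The result     *)
(* contains the entry bumped out of the first column.                         *)
Fixpoint rev_insert (cs : columns) (y : nat) : columns * nat :=
  match cs with
  | [::] => ([::], y)
  | c :: cs' =>
      let r := rev_insert cs' y in
      let k := last 0 [seq k <- iota 0 (size c) | nth 0 c k <= r.2] in
      (set_nth 0 c k r.2 :: r.1, nth 0 c k)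
  end.

Definition rev_bump (T : columns) (b : box) : columns * nat :=
  let r := rev_insert (take b.2.-1 T) (entry T b) in
  (r.1 ++ drop b.2.-1 (del_box T b), r.2).

(* The box of the right-most occurrence of the maximal entry. *)
Definition max_box (T : columns) : box :=
  let m := \max_(x <- flatten T) x in
  let j := last 0 [seq j <- iota 0 (size T) | m \in nth [::] T j] in
  ((index m (nth [::] T j)).+1, j.+1).

Fixpoint rev_bumping (k : nat) (T1 T2 : columns) : array :=
  match k with
  | 0 => [::]
  | k'.+1 =>
      let b := max_box T1 in
      let r := rev_bump T2 b in
      rcons (rev_bumping k' (del_box T1 b) r.1) (entry T1 b, r.2)
  end.

Section IntermediateSetsAndMaps.

Variables (n N : nat) (lam1 nu1 lam2 nu2 : seq nat).

Notation kappa1 := (skew lam1 nu1).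
Notation kappa2 := (skew lam2 nu2).

(* Extension by 0 of a filling of kappa1 to all boxes. *)
Definition fill_at (S : {ffun seq_sub kappa1 -> nat}) (b : box) : nat :=
  oapp S 0 (insub b).

(* S(kappa1, kappa2) *)
Definition LR_skew_tableaux : set {ffun seq_sub kappa1 -> nat} :=
  [set S | [/\ semistandard n kappa1 (fill_at S),
               forall i, 0 < i -> count_mem i (ME lam1 nu1 (fill_at S)) =
                                  rowlen nu2 i - rowlen lam2 i
             & adds_to lam2 nu2 (ME lam1 nu1 (fill_at S))]].

(* W(kappa1, kappa2) *)
Definition LR_arrays : set array :=
  [set w | [/\ size w = N, lexicographic w,
               forall i, 0 < i ->
                 count_mem i (unzip1 w) = rowlen nu1 i - rowlen lam1 i,
               forall i, 0 < i ->
                 count_mem i (unzip2 w) = rowlen nu2 i - rowlen lam2 i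
             & exists mu, [/\ young mu,
                 LR_crystal n mu lam2 nu2 (bumping w).2
               & LR_crystal n mu lam1 nu1 (bumping w).1]]].

Definition S1 (f : {ffun seq_sub kappa1 -> box}) : {ffun seq_sub kappa1 -> nat} :=
  [ffun b => (f b).1].

Definition S2 (S : {ffun seq_sub kappa1 -> nat}) : array :=
  [seq (b.1, fill_at S b) | b <- kappa1].

Definition S3 (w : array) : seq nat * columns * columns :=
  (row_shape (bumping w).2, (bumping w).1, (bumping w).2).

Definition C3 (t : seq nat * columns * columns) : array :=
  rev_bumping (sumn t.1.1) t.1.2 t.2.

Definition C2 (w : array) : {ffun seq_sub kappa1 -> nat} :=
  [ffun b => nth 0 (unzip2 w) (index (val b) kappa1)].

(* The boxes with entry S b lie in distinct columns, so the position of b     *)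
(* among them, counted from the right, is the number of those weakly to the   *)
(* right of b.                                                                *)
Definition position (S : {ffun seq_sub kappa1 -> nat}) (b : seq_sub kappa1) :
    nat :=
  #|[pred c | (S c == S b) && ((val b).2 <= (val c).2)]|.

Definition C1 (S : {ffun seq_sub kappa1 -> nat}) : {ffun seq_sub kappa1 -> box} :=
  [ffun b => (S b, rowlen lam2 (S b) + position S b)].

Definition mapS : {ffun seq_sub kappa1 -> box} -> seq nat * columns * columns :=
  S3 \o S2 \o S1.

Definition mapC : seq nat * columns * columns -> {ffun seq_sub kappa1 -> box} :=
  C1 \o C2 \o C3.

End IntermediateSetsAndMaps.

Arguments pictures : clear implicits.
Arguments LR_skew_tableaux : clear implicits.
Arguments S1 : clear implicits.
Arguments S2 : clear implicits.
Arguments C1 : clear implicits.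
Arguments C2 : clear implicits.
Arguments mapS : clear implicits.
Arguments mapC : clear implicits.
Arguments tableaux : clear implicits.
Arguments LR_crystal : clear implicits.
Arguments LR_pairs : clear implicits.
Arguments LR_arrays : clear implicits.

(* Main.v *)
(* A picture is determined by its first coordinates, and these form a skew     *)
(* tableau S; being PJ-standard in both directions amounts to S being          *)
(* semistandard with the ballot condition relative to lambda^2. Reading S row  *)
(* by row turns the rest into RSK by column insertion. Insertion is analysed   *)
(* one column at a time: an array leaves in the first column of each of the    *)
(* two tableaux a column, and passes the array of bumped entries on to the     *)
(* next column. Two facts about a single column then propagate through the     *)
(* tableaux. First, bumping is a Knuth move, hence preserves the ballot        *)
(* condition of the second row of the array. Secondly, if two consecutive      *)
(* weakly decreasing words are inserted, the vertical inequalities between     *)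
(* them hold if and only if they hold between the two words of bumped entries; *)
(* so the strictness of the columns of S is equivalent to the ballot condition *)
(* relative to lambda^1 for the recording tableau.                             *)

(* Each of the three pairs of maps is shown to be mutually inverse, and the theorem is their
   composition.

   Pictures: in the middle-eastern reading of S, the letter of a box x adds to the growing diagram
   exactly the box f(x). So f is recovered from its row coordinates ([picture_position]), and the
   PJ-standardness of the inverse of f corresponds to the growth condition ([picture_lattice],
   [C1_le_J]).

   Growth: the diagrams along a word are all Young diagrams if and only if every two adjacent rows
   stay in order ([adds_toP]). This condition [lattice] is invariant under Knuth moves, so it may be
   tested on the row reading of a tableau, on its columns, or on the word that was inserted
   ([lat_equiv_row_reading], [lat_equiv_bumping]). That settles the condition on the bumped tableau.

   Recording tableau: its growth condition is compared with the column strictness of S by induction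
   along the columns; [rows_strict_bumped] is the induction step and [lattice_bumping_labels] the
   outcome. [LR_arraysP] gathers both conditions as conditions on the array alone, and
   [LR_skew_arrays] recognises them as those defining the skew tableaux.

   Arrays against pairs of tableaux: [bumpingK] and [rev_bumpingP] show that reverse bumping inverts
   bumping. What makes the right-most maximal label the correct box to remove is the order of new
   boxes, [new_box_right] and [new_box_left]. *)
Require Import Defs.
From mathcomp Require Import all_boot zify.
From mathcomp Require Import classical_sets functions.

Set Implicit Arguments.
Unset Strict Implicit.
Unset Printing Implicit Defensive.

(** * Adding boxes to a Young diagram *)

(* lia takes [@size nat] and [@size (Equality.sort nat)] for different atoms. *)
Ltac slia :=
  repeat match goal with H : _ |- _ =>
    progress change (Equality.sort Datatypes_nat__canonical__eqtype_Equality)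
      with nat in H end;
  try change (Equality.sort Datatypes_nat__canonical__eqtype_Equality) with nat;
  lia.

(** In a weakly decreasing sequence a zero is followed by zeros only, so it is enough to look at the
    last entry; the default 1 admits the empty diagram. *)
Lemma youngP l :
  reflect (last 1 l != 0 /\ forall j, nth 0 l j.+1 <= nth 0 l j) (young l).
Proof.
apply: (iffP andP) => [[/(sortedP 0) sl l0]|[ll sl]].
  split=> [|j].
    case: l l0 {sl} => [|x l] //= l0; apply/negP => /eqP e.
    by move/negP: l0; apply; rewrite -e mem_last.
  case: (ltnP j.+1 (size l)) => [/sl //|?]; by rewrite nth_default.
split; first by apply/(sortedP 0) => j _; apply: sl.
apply/negP => /(nthP 0)[j jl ej].
have mono k : nth 0 l (j + k) = 0.
  elim: k => [|k IH]; first by rewrite addn0.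
  by apply/eqP; rewrite addnS -leqn0 -{2}IH.
have := mono ((size l).-1 - j); rewrite subnKC; last by rewrite -ltnS (ltn_predK jl).
by rewrite nth_last; case: (l) ll jl => [|x s] //= /negP h _ /eqP.
Qed.

Lemma young_nth l j k : young l -> j <= k -> nth 0 l k <= nth 0 l j.
Proof.
case/youngP => _ sl /subnKC <-; elim: (k - j) => [|m IH]; first by rewrite addn0.
by rewrite addnS (leq_trans (sl _)).
Qed.

Lemma young_eq l l' : young l -> young l' -> (forall j, nth 0 l j = nth 0 l' j) -> l = l'.
Proof.
suff H a b : young a -> young b -> (forall j, nth 0 a j = nth 0 b j) -> size a <= size b.
  move=> yl yl' e; apply: (@eq_from_nth _ 0) => [|j _ //].
  by apply/eqP; rewrite eqn_leq !H.
move=> /andP[_ a0] _ e; rewrite leqNgt; apply/negP => lt.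
by move/negP: a0; apply; rewrite -(nth_default 0 (leqnn (size b))) -e mem_nth.
Qed.

(** [add_box] passes to [i.-1], so a letter 0 would act as a letter 1; excluding it keeps the count
    exact. *)
Lemma nth_add_boxes lam w j :
  0 \notin w -> nth 0 (add_boxes lam w) j = nth 0 lam j + count_mem j.+1 w.
Proof.
rewrite /add_boxes; elim: w lam => [|x w IH] lam /=; first by rewrite addn0.
rewrite inE negb_or => /andP[x0 w0]; rewrite IH // nth_incr_nth.
case: x x0 => [|x] //= _; rewrite eqSS; lia.
Qed.

(** When [incr_nth] prolongs the list, it pads with zeros only in front of the new last entry 1. By
    [youngP], what remains to be checked along a word are inequalities between adjacent rows. *)
Lemma last_add_boxes lam w : last 1 lam != 0 -> last 1 (add_boxes lam w) != 0.
Proof.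
rewrite /add_boxes; elim: w lam => [|x w IH] lam //= ll; apply: IH.
rewrite /add_box; move: (x.-1) => i.
have nz : 0 < size (incr_nth lam i) by rewrite size_incr_nth; case: ifP => //; lia.
have -> : last 1 (incr_nth lam i) = nth 0 (incr_nth lam i) (size (incr_nth lam i)).-1.
  by case: (incr_nth lam i) nz => //= a s _; rewrite (last_nth 0).
rewrite nth_incr_nth size_incr_nth; case: (ltnP i (size lam)) => [|_]; last by rewrite eqxx.
by case: lam ll {nz} => //= a s; rewrite (last_nth 0) /=; lia.
Qed.

(* The condition imposed by the rows i and i + 1 when boxes are added one by   *)
(* one along w, h being the initial difference of the two row lengths.         *)
Fixpoint lattice (i h : nat) (w : seq nat) : bool :=
  match w with
  | [::] => true
  | x :: w' =>
      if x == i then lattice i h.+1 w'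
      else if x == i.+1 then (0 < h) && lattice i h.-1 w'
      else lattice i h w'
  end.

(** The truncated subtraction is harmless: where the first factor holds, [lattice_count] makes it
    exact. *)
Lemma lattice_cat i h u v : lattice i h (u ++ v) =
  lattice i h u && lattice i (h + count_mem i u - count_mem i.+1 u) v.
Proof.
elim: u h => [|x u IH] h /=; first by rewrite addn0 subn0.
case: eqP => [->|_]; first by rewrite IH ltn_eqF // addnA addn1 add0n.
case: eqP => [_|_]; last by rewrite IH.
rewrite IH; case: h => //= h; congr (_ && lattice _ _ _); lia.
Qed.

Lemma lattice_count i h w : lattice i h w -> count_mem i.+1 w <= h + count_mem i w.
Proof.
elim: w h => [|x w IH] h //=.
case: eqP => [->|_]; first by move/IH; rewrite ltn_eqF //; slia.
case: eqP => [_|_]; last by move/IH; slia.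
by case/andP => h0 /IH; slia.
Qed.

Lemma latticeP i h w :
  reflect (forall k, count_mem i.+1 (take k w) <= h + count_mem i (take k w))
          (lattice i h w).
Proof.
apply: (iffP idP) => [lw k|].
  by apply: lattice_count; move: lw; rewrite -{1}(cat_take_drop k w) lattice_cat => /andP[].
elim/last_ind: w => [|w x IH] //= H.
rewrite -cats1 lattice_cat; apply/andP; split.
  (* Cutting at [size w] keeps the last letter x out of the prefix when k is large. *)
  apply: IH => k; have := H (minn k (size w)).
  rewrite -cats1 takel_cat ?geq_minr // !take_min !take_size.
  by [].
have := H (size (rcons w x)); rewrite take_size -cats1 !count_cat /=.
case: eqP => [//|_]; case: eqP => [_|//]; lia.
Qed.

(** The growth condition splits into independent conditions, one for each pair of adjacent rows,
    which involve only the letters i and i + 1. *)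
Lemma adds_toP lam nu w : young lam -> young nu -> 0 \notin w ->
  adds_to lam nu w <->
  (forall i, 0 < i -> lattice i (rowlen lam i - rowlen lam i.+1) w) /\
  (forall i, 0 < i -> rowlen nu i = rowlen lam i + count_mem i w).
Proof.
move=> yl yn w0.
have t0 k : 0 \notin take k w by apply: contra w0; apply: mem_take.
split=> [[H <-]|[H1 H2]]; last first.
  have yk k : young (add_boxes lam (take k w)).
    apply/youngP; split; first by apply: last_add_boxes; case/youngP: yl.
    move=> j; rewrite !nth_add_boxes //.
    have /latticeP/(_ k) := H1 j.+1 isT; rewrite /rowlen /=.
    by have := young_nth yl (leqnSn j); lia.
  split=> [k _|]; first exact: yk.
  apply: young_eq => // [|j]; first by have := yk (size w); rewrite take_size.
  by rewrite nth_add_boxes //; have := H2 j.+1 isT; rewrite /rowlen.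
split=> [[//|i] _|[//|i] _]; last by rewrite /rowlen nth_add_boxes.
apply/latticeP => k; rewrite /rowlen /=; have ylS := young_nth yl (leqnSn i).
(* [adds_to] speaks of prefixes of length 1 to [size w]; the empty prefix gives [lam] itself, and
   longer ones repeat the whole word. *)
have yk : young (add_boxes lam (take k w)).
  case: (posnP k) => [->|k0]; first by rewrite take0.
  case: (posnP (size w)) => [/size0nil ->//|s0].
  have -> : take k w = take (minn k (size w)) w by rewrite take_min take_size.
  by apply: H; slia.
have := young_nth yk (leqnSn i); rewrite !nth_add_boxes //; slia.
Qed.

(** * Knuth moves and conjugate shapes *)

(* A consequence of Knuth equivalence, all that is needed of it.               *)
Definition lat_equiv (u v : seq nat) : Prop :=
  perm_eq u v /\ forall i h, lattice i h u = lattice i h v.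

Lemma lat_equiv_refl u : lat_equiv u u.
Proof. by split. Qed.

Lemma lat_equiv_trans v u w : lat_equiv u v -> lat_equiv v w -> lat_equiv u w.
Proof.
by case=> p e [p' e']; split=> [|i h]; [apply: perm_trans p p' | rewrite e e'].
Qed.

Lemma lat_equiv_cat u v u' v' :
  lat_equiv u v -> lat_equiv u' v' -> lat_equiv (u ++ u') (v ++ v').
Proof.
case=> p e [p' e']; split=> [|i h]; first exact: perm_cat.
by rewrite !lattice_cat e e' !(permP p).
Qed.

Lemma lat_equiv_cons x u v : lat_equiv u v -> lat_equiv (x :: u) (x :: v).
Proof. by apply: lat_equiv_cat (lat_equiv_refl [:: x]). Qed.

(** Exchanging x and z matters only if x = i and z = i + 1; then y = i comes first and makes room
    for z in either order. *)
Lemma knuth_right x y z : x <= y -> y < z -> lat_equiv [:: y; z; x] [:: y; x; z].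
Proof.
move=> xy yz; split=> [|i h]; first by rewrite perm_cons (perm_catC [:: z] [:: x]).
rewrite /=; do !case: eqP => //= ?; subst; rewrite ?andbT //; lia.
Qed.

(** Exchanging a and y matters only if a = i and y = i + 1; then x = i + 1 as well, and two letters
    i + 1 against one i require 0 < h in either order. *)
Lemma knuth_left x y a : a < x -> x <= y -> lat_equiv [:: a; y; x] [:: y; a; x].
Proof.
move=> ax xy; split=> [|i h]; first by rewrite (perm_catCA [:: a] [:: y] [:: x]).
rewrite /=; do !case: eqP => //= ?; subst; rewrite ?andbT //; lia.
Qed.

Lemma bump_right x y B : x <= y -> path ltn y B -> lat_equiv (y :: rcons B x) (y :: x :: B).
Proof.
elim: B y => [|b B IH] y xy /=; first by move=> _; apply: lat_equiv_refl.
case/andP => yb pB.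
apply: lat_equiv_trans (lat_equiv_cons y (IH _ (leq_trans xy (ltnW yb)) pB)) _.
exact: lat_equiv_cat (knuth_right xy yb) (lat_equiv_refl B).
Qed.

Lemma sorted_ltn_rcons c x :
  sorted ltn (rcons c x) = sorted ltn c && all (fun z => z < x) c.
Proof. by rewrite !(sorted_pairwise ltn_trans) pairwise_rcons andbC. Qed.

Lemma all_take_find x c : all (fun z => z < x) (take (find (leq x) c) c).
Proof. by elim: c => [|y c IH] //=; case: (leqP x y) => //= ->. Qed.

Lemma bump_left x y A : x <= y -> sorted ltn (rcons A x) ->
  lat_equiv (A ++ [:: y; x]) (y :: rcons A x).
Proof.
elim/last_ind: A x => [|A a IH] x xy sA; first exact: lat_equiv_refl.
move: sA; rewrite sorted_ltn_rcons all_rcons => /and3P[sA' ax _].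
rewrite -(cats1 _ x) -{1}cats1 -catA.
apply: lat_equiv_trans (lat_equiv_cat (lat_equiv_refl A) (knuth_left ax xy)) _.
rewrite (catA A [:: y; a] [:: x]).
exact: lat_equiv_cat (IH _ (leq_trans (ltnW ax) xy) sA') (lat_equiv_refl _).
Qed.

(** The new letter x travels left past the entries below the one it replaces ([bump_right]); the
    bumped entry then travels left past the entries above ([bump_left]). *)
Lemma lat_equiv_bump x c (k := find (leq x) c) : sorted ltn c -> k < size c ->
  lat_equiv (rcons c x) (nth 0 c k :: set_nth 0 c k x).
Proof.
move=> sc kc; have xy : x <= nth 0 c k by apply: (@nth_find _ 0); rewrite has_find.
rewrite -{1}(cat_take_drop k c) (drop_nth 0 kc) rcons_cat rcons_cons.
move: sc; rewrite -{1}(cat_take_drop k c) (drop_nth 0 kc) => sc.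
have sA : sorted ltn (rcons (take k c) x).
  by rewrite sorted_ltn_rcons all_take_find (cat_sorted2 sc).
have sB : path ltn (nth 0 c k) (drop k.+1 c) by case/cat_sorted2: sc.
apply: lat_equiv_trans (lat_equiv_cat (lat_equiv_refl _) (bump_right xy sB)) _.
rewrite (catA _ [:: _; x]) set_nthE kc -cat_cons -(cat_rcons x).
exact: lat_equiv_cat (bump_left xy sA) (lat_equiv_refl _).
Qed.

(** Every letter of X is followed by one that is not larger, so [bump_left] carries it over all of
    c; the last letter x stays behind and prolongs c. This is the passage from reading by rows to
    reading by columns. *)
Lemma lat_equiv_bump_row c X x : sorted ltn c -> all (fun z => z < x) c ->
  sorted geq (rcons X x) -> lat_equiv (c ++ rcons X x) (X ++ rcons c x).
Proof.
move=> sc cx.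
have gt_x b Y : path geq b (rcons Y x) -> x <= b.
  elim: Y b => [|z Y IH] b /=; first by rewrite andbT.
  by case/andP => zb /IH /leq_trans; apply.
have bump b b' : x <= b -> b' <= b -> x <= b' ->
    lat_equiv (c ++ [:: b; b']) (b :: c ++ [:: b']).
  move=> xb b'b xb'; rewrite cats1; apply: bump_left b'b _.
  rewrite sorted_ltn_rcons sc; apply: sub_all cx => z zx; exact: leq_trans zx xb'.
elim: X => [|b X IH] /=; first by rewrite cats1 => _; apply: lat_equiv_refl.
move=> pX; have IH' := IH (path_sorted pX).
apply: lat_equiv_trans (lat_equiv_cons b IH').
case: X pX {IH IH'} => [|b' X] /= /andP[b'b pX].
  exact: bump.
have := bump b b' (leq_trans (gt_x _ _ pX) b'b) b'b (gt_x _ _ pX).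
by move/lat_equiv_cat/(_ (lat_equiv_refl (rcons X x))); rewrite /= -!catA.
Qed.

(** Transposition of diagrams: both sides say that the box in row i and column j, counted from 0,
    belongs to the diagram. *)
Lemma ltn_nth_count s i j : sorted geq s ->
  (j < nth 0 s i) = (i < count (leq j.+1) s).
Proof.
elim: s i => [|x s IH] i /=; first by rewrite nth_nil.
rewrite (path_sortedE (rev_trans leq_trans)) => /andP[sx ss].
case: (ltnP j x) => jx; first by case: i => [|i] //=; rewrite IH.
rewrite add0n -IH //; case: i => [|i] /=; rewrite ltnNge.
  rewrite jx /= ltnNge (leq_trans _ jx) //.
  by case: (s) sx => //= a l /andP[].
rewrite [in RHS]ltnNge; congr (~~ _).
case: (ltnP i.+1 (size s)) => il; last first.
  case: (ltnP i (size s)) => il'; last by rewrite !nth_default.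
  by rewrite (leq_trans _ jx) ?(nth_default _ il) //; apply: (allP sx); apply: mem_nth.
by rewrite !(leq_trans _ jx) //; apply: (allP sx); apply: mem_nth => //; exact: ltnW.
Qed.

Lemma nth_conj_shape s j : sorted geq s -> nth 0 (conj_shape s) j = count (leq j.+1) s.
Proof.
move=> ss; rewrite /conj_shape; case: (ltnP j (head 0 s)) => jh.
  by rewrite (nth_map 0) ?size_iota // nth_iota.
rewrite nth_default ?size_map ?size_iota //; apply/esym/eqP.
by rewrite -leqn0 leqNgt -ltn_nth_count // nth0 -leqNgt.
Qed.

Lemma young_conj s : young s -> young (conj_shape s).
Proof.
case/andP => ss s0; apply/andP; split.
  apply/(sortedP 0) => i _; rewrite !nth_conj_shape //; apply: sub_count => x.
  exact: leq_trans.
apply/negP => /mapP[j]; rewrite mem_iota => /andP[j0 jh] /esym/eqP.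
case: j j0 jh => // j _ jh; rewrite -leqn0 leqNgt -ltn_nth_count // nth0.
by rewrite -ltnS -add1n jh.
Qed.

Lemma conj_shapeK s : young s -> conj_shape (conj_shape s) = s.
Proof.
move=> ys; have /andP[ss s0] := ys; have /andP[sc _] := young_conj ys.
apply: young_eq => // [|i]; first exact/young_conj/young_conj.
apply/eqP; rewrite nth_conj_shape // eqn_leq; apply/andP; split; last first.
  case e: (nth 0 s i) => [//|j]; rewrite -ltn_nth_count // nth_conj_shape //.
  by rewrite -ltn_nth_count // e.
case e: (count _ _) => [//|j].
have : j < count (leq i.+1) (conj_shape s) by rewrite e.
by rewrite -ltn_nth_count // nth_conj_shape // -ltn_nth_count.
Qed.

Lemma sumn_conj_shape s : sorted geq s -> sumn (conj_shape s) = sumn s.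
Proof.
move=> ss; have le_h : all (leq^~ (head 0 s)) s.
  by case: s ss => //= x s; rewrite leqnn (path_sortedE (rev_trans leq_trans)) => /andP[].
(* The range of summation is kept at the head of s while the induction runs over an arbitrary t with
   entries below this bound. *)
suff H t : all (leq^~ (head 0 s)) t ->
    sumn [seq count (leq j) t | j <- iota 1 (head 0 s)] = sumn t by exact: H.
elim: t => [_|x t IH] /=.
  by elim: (iota _ _) => //= a l ->.
case/andP => xh /IH <-.
have e : x = sumn [seq nat_of_bool (j <= x) | j <- iota 1 (head 0 s)].
  rewrite -{1}(minn_idPl xh); elim: (head 0 s) {xh IH} => [|h IH].
    by rewrite minn0.
  rewrite -addn1 iotaD map_cat sumn_cat -IH /=; lia.
rewrite [RHS](congr1 (addn^~ _) e) {e xh IH}; elim: (iota _ _) => [|a l IHl] //=; lia.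
Qed.

(** * Tableaux by columns *)

Lemma all_flatten (A : Type) (p : pred A) (ss : seq (seq A)) :
  all p (flatten ss) = all (all p) ss.
Proof. by elim: ss => //= s ss IH; rewrite all_cat IH. Qed.

(** The condition for c' to stand next to c on its right. It is void for the empty column that [tab]
    supplies after the last one. *)
Definition col_le (c c' : seq nat) : Prop :=
  size c' <= size c /\ forall r, r < size c' -> nth 0 c r <= nth 0 c' r.

Fixpoint tab (T : columns) : Prop :=
  match T with
  | [::] => True
  | c :: T' => [/\ sorted ltn c, c != [::], col_le c (head [::] T') & tab T']
  end.

Lemma tab_nth T : tab T <-> forall j, j < size T ->
  [/\ sorted ltn (nth [::] T j), nth [::] T j != [::]
    & col_le (nth [::] T j) (nth [::] T j.+1)].
Proof.
elim: T => [|c T [IH1 IH2]] //=; split.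
  case=> sc c0 cc tT [|j] jT; last exact: IH1.
  by split=> //; rewrite nth0.
move=> H; have [sc c0] := H 0 isT; rewrite /= nth0 => cc.
by split=> //; apply: IH2 => j jT; apply: (H j.+1).
Qed.

Lemma tab_shape T : tab T -> young (map size T).
Proof.
move=> /tab_nth tT; apply/andP; split.
  apply/(sortedP 0) => j; rewrite size_map => jT.
  by rewrite !(nth_map [::]) ?(ltnW jT) //; have [_ _ []] := tT _ (ltnW jT).
apply/negP => /mapP[c /(nthP [::])[j jT <-]] /esym/eqP; rewrite size_eq0.
by apply/negP; case: (tT j jT).
Qed.

Lemma mem_diagram (T : columns) mu i j : young mu -> map size T = conj_shape mu ->
  ((i.+1, j.+1) \in diagram mu) = (i < size (nth [::] T j)).
Proof.
move=> /andP[smu _] e; rewrite mem_skew /rowlen /= nth_nil /= ltn_nth_count //.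
rewrite -nth_conj_shape // -e; case: (ltnP j (size T)) => jT.
  by rewrite (nth_map [::]).
by rewrite !nth_default // size_map.
Qed.

Lemma semistandard_tab n (T : columns) mu : young mu -> map size T = conj_shape mu ->
  semistandard n (diagram mu) (entry T) <->
  tab T /\ all (fun x => 1 <= x <= n.+1) (flatten T).
Proof.
move=> ymu e; have ys : young (map size T) by rewrite e young_conj.
have [sT T0] := andP ys.
have memT i j := mem_diagram i j ymu e.
split=> [[H1 H2 H3]|[/tab_nth tT +]].
  split; last first.
    rewrite all_flatten; apply/allP => c /(nthP [::])[j jT <-].
    apply/(all_nthP 0) => i iT.
    by apply: (H1 (i.+1, j.+1)); rewrite memT.
  apply/tab_nth => j jT; split.
  - apply/(sortedP 0) => i iT.
    have := H3 (i.+1, j.+1) (i.+2, j.+1); rewrite /entry /=; apply=> //.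
      by rewrite memT ltnW.
    by rewrite memT.
  - apply: contra T0 => /eqP cj; apply/mapP; exists (nth [::] T j) => //.
      exact: mem_nth.
    by rewrite cj.
  have sz : size (nth [::] T j.+1) <= size (nth [::] T j).
    case: (ltnP j.+1 (size T)) => jT'; last by rewrite (nth_default _ jT').
    by have := (sortedP 0 sT) j; rewrite size_map !(nth_map [::]) //; apply.
  split=> // r rT; have := H2 (r.+1, j.+1) (r.+1, j.+2); rewrite /entry /=; apply=> //.
    by rewrite memT (leq_trans rT).
  by rewrite memT.
rewrite all_flatten => /allP aT.
have mem0 b : b \in diagram mu -> exists i j, b = (i.+1, j.+1).
  by case: b => [[|i] [|j]]; rewrite mem_skew //=; exists i, j.
have jT i j : i < size (nth [::] T j) -> j < size T.
  by move=> h; rewrite ltnNge; apply/negP => h'; rewrite nth_default in h.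
split.
- move=> b bm; have [i [j eb]] := mem0 _ bm; subst b; rewrite memT in bm.
  have jj := jT _ _ bm; have := aT _ (mem_nth [::] jj) => /(all_nthP 0); exact.
- move=> b c bm cm; have [i [j eb]] := mem0 _ bm; have [i' [j' ec]] := mem0 _ cm.
  subst b c; rewrite !memT in bm cm; rewrite /= ltnS => -[ei] jj'; subst i'.
  rewrite /entry /=; elim: j' jj' cm => [|k IH].
    by rewrite leqn0 => /eqP -> //.
  rewrite leq_eqVlt => /predU1P[-> //|jk] cm.
  have kT : k < size T by apply: ltnW (jT _ _ cm).
  have [_ _ [sz le]] := tT _ kT.
  exact: leq_trans (IH jk (leq_trans cm sz)) (le _ cm).
- move=> b c bm cm; have [i [j eb]] := mem0 _ bm; have [i' [j' ec]] := mem0 _ cm.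
  subst b c; rewrite !memT in bm cm; rewrite /= ltnS => -[ej] ii'; subst j'.
  have [sc _ _] := tT _ (jT _ _ cm); rewrite /entry /=.
  by rewrite (sorted_ltn_nth ltn_trans 0 sc).
Qed.

Lemma tab_row_shape (T : columns) mu : young mu -> map size T = conj_shape mu -> row_shape T = mu.
Proof. by move=> ymu e; rewrite /row_shape e conj_shapeK. Qed.

Lemma tableauxP n mu T : young mu ->
  tableaux n mu T <->
  [/\ tab T, row_shape T = mu & all (fun x => 1 <= x <= n.+1) (flatten T)].
Proof.
move=> ymu; split=> [[e /(semistandard_tab n ymu e)[tT aT]]|[tT <- aT]].
  by split=> //; apply: tab_row_shape.
have ys := tab_shape tT.
have e : map size T = conj_shape (row_shape T) by rewrite conj_shapeK.
by split=> //; apply/semistandard_tab => //; apply: young_conj.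
Qed.

Definition tableau_row (T : columns) (r : nat) : seq nat :=
  [seq nth 0 c r | c <- T & r < size c].

(** The number m of rows is only a bound, rows past the first column being empty; so it can stay
    fixed while columns are removed. *)
Definition row_reading (m : nat) (T : columns) : seq nat :=
  flatten [seq rev (tableau_row T r) | r <- iota 0 m].

Lemma tableau_row_nth T r : tab T ->
  tableau_row T r = [seq nth 0 (nth [::] T j) r | j <- iota 0 (count (ltn r) (map size T))].
Proof.
elim: T => [|c T IH] //= tT; rewrite /tableau_row /=.
case: ifP => rc /=.
  case: tT => _ _ _ /IH; rewrite /tableau_row => ->.
  by rewrite -[1]addn0 iotaDl -map_comp.
have : all (geq (size c)) (map size T).
  have /andP[/= + _] := @tab_shape (c :: T) tT.
  by rewrite (path_sortedE (rev_trans leq_trans)) => /andP[].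
move/negbT: rc; rewrite -leqNgt => rc /allP h.
have h' x : x \in map size T -> r < x = false.
  by move/h => xc; apply/negbTE; rewrite -leqNgt (leq_trans _ rc).
rewrite add0n; have -> : count (ltn r) (map size T) = 0.
  by rewrite (eq_in_count (a2 := pred0)) ?count_pred0 // => x /h'.
rewrite (eq_in_filter (a2 := pred0)) ?filter_pred0 // => x xT; apply: h'.
exact: map_f.
Qed.

Lemma ME_row_reading (T : columns) mu : young mu -> tab T -> map size T = conj_shape mu ->
  ME [::] mu (entry T) = row_reading (size mu) T.
Proof.
move=> ymu tT e; rewrite /ME /skew /row_reading map_flatten -map_comp.
rewrite -[1]addn0 iotaDl -map_comp; congr flatten; apply: eq_map => r /=.
rewrite /rowlen /= nth_nil subn0 -map_comp tableau_row_nth // e.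
have /andP[sc _] := young_conj ymu.
have -> : count (ltn r) (conj_shape mu) = nth 0 mu r.
  by rewrite -[in RHS](conj_shapeK ymu) nth_conj_shape.
by rewrite map_rev -[1]addn0 iotaDl -map_comp.
Qed.

Lemma row_readingS m T : row_reading m.+1 T = row_reading m T ++ rev (tableau_row T m).
Proof. by rewrite /row_reading -addn1 iotaD map_cat flatten_cat /= cats0. Qed.

Lemma nth_map_size (T : columns) j : nth 0 (map size T) j = size (nth [::] T j).
Proof. exact: nth_shape. Qed.

Lemma tableau_row_sorted T r : tab T -> sorted leq (tableau_row T r).
Proof.
move=> tT; have /andP[sT _] := tab_shape tT; rewrite tableau_row_nth //.
apply/(sortedP 0) => j; rewrite size_map size_iota => jm.
rewrite !(nth_map 0) ?size_iota ?(ltnW jm) // !nth_iota ?(ltnW jm) //= !add0n.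
move: jm; rewrite -ltn_nth_count // nth_map_size => rj.
have jT : j < size T by apply: ltnW; rewrite ltnNge; apply/negP => h; rewrite nth_default in rj.
by have /tab_nth/(_ _ jT)[_ _ [_]] := tT; apply.
Qed.

Lemma tableau_row_nil T r : tab T -> size (head [::] T) <= r -> tableau_row T r = [::].
Proof.
move=> tT; have /andP[sT _] := tab_shape tT; rewrite tableau_row_nth // leqNgt -nth0 -nth_map_size.
by rewrite ltn_nth_count // -leqNgt leqn0 => /eqP ->.
Qed.

(** This trades the row reading, in which the Littlewood-Richardson condition is stated, for the
    reading by columns from right to left, which fits the analysis of bumping column by column. *)
Lemma lat_equiv_row_reading m T : tab T -> size (head [::] T) <= m ->
  lat_equiv (row_reading m T) (flatten (rev T)).
Proof.
elim: T => [|c T IH] /= tT cm.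
  rewrite /row_reading; elim: (iota 0 m) => //= *; exact: lat_equiv_refl.
have [sc c0 [sz cc] tT'] := tT.
rewrite rev_cons -cats1 flatten_cat /= cats0.
apply: lat_equiv_trans (lat_equiv_cat (IH tT' (leq_trans sz cm)) (lat_equiv_refl c)).
(* Inner induction on the number k of rows read: the first k rows of [c :: T] are equivalent to the
   first k rows of T followed by the top k entries of c. The next row is absorbed by
   [lat_equiv_bump_row]. *)
rewrite -[X in _ ++ X](take_oversize cm); elim: (m) => [|k IHk].
  by rewrite take0; apply: lat_equiv_refl.
rewrite !row_readingS.
apply: lat_equiv_trans (lat_equiv_cat IHk (lat_equiv_refl _)) _.
rewrite -!catA; apply: lat_equiv_cat; first exact: lat_equiv_refl.
case: (ltnP k (size c)) => kc; last first.
  have e0 : tableau_row T k = [::].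
    by apply: tableau_row_nil => //; apply: leq_trans kc.
  rewrite /tableau_row /= ltnNge kc /= -/(tableau_row T k) e0 !take_oversize ?(leq_trans kc) //.
  by rewrite cats0; apply: lat_equiv_refl.
have -> : tableau_row (c :: T) k = nth 0 c k :: tableau_row T k by rewrite /tableau_row /= kc.
rewrite rev_cons (take_nth 0) //; apply: lat_equiv_bump_row.
- exact: take_sorted.
- by have := sc; rewrite -{1}(cat_take_drop k c) (drop_nth 0 kc) -cat_rcons
    => /cat_sorted2[+ _]; rewrite sorted_ltn_rcons => /andP[].
have := @tableau_row_sorted (c :: T) k tT; rewrite /tableau_row /= kc -rev_cons => h.
by rewrite rev_sorted.
Qed.

(** * Column bumping, one column at a time *)

Definition lex_rel (p q : nat * nat) : bool :=
  (p.1 < q.1) || (p.1 == q.1) && (q.2 <= p.2).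

Lemma lex_rel_trans : transitive lex_rel.
Proof. by move=> [b a] [b' a'] [b'' a'']; rewrite /lex_rel /=; lia. Qed.

Lemma lexicographicP w : lexicographic w <-> sorted lex_rel w.
Proof.
split=> [H|/(sortedP (0, 0)) H k /H]; last by rewrite /lex_rel /=; lia.
apply/(sortedP (0, 0)) => k /H; rewrite /lex_rel /=.
case: ltngtP => //= [_ [] //|e [_]]; exact.
Qed.

(* The effect of column bumping on the first column alone, for both tableaux:  *)
(* the third component is the array of the entries bumped out of it, each one  *)
(* with the label current at that time. This array is what the second column   *)
(* receives.                                                                   *)
Definition col_step (st : seq nat * seq nat * array) (p : nat * nat) :=
  let k := find (leq p.2) st.1.2 in
  if k < size st.1.2 then
    (st.1.1, set_nth 0 st.1.2 k p.2, rcons st.2 (p.1, nth 0 st.1.2 k))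
  else (rcons st.1.1 p.1, rcons st.1.2 p.2, st.2).

Definition col_run (w : array) : seq nat * seq nat * array :=
  foldl col_step ([::], [::], [::]) w.

Definition labels w := (col_run w).1.1.
Definition column w := (col_run w).1.2.
Definition bumped w := (col_run w).2.

Lemma col_run_rcons w p : col_run (rcons w p) = col_step (col_run w) p.
Proof. by rewrite /col_run foldl_rcons. Qed.

Lemma bumping_rcons w p : bumping (rcons w p) = bumping_step (bumping w) p.
Proof. by rewrite /bumping foldl_rcons. Qed.

Lemma size_set_nth_lt (c : seq nat) k x : k < size c -> size (set_nth 0 c k x) = size c.
Proof. by rewrite size_set_nth => /maxn_idPr. Qed.

Lemma set_nth_size (c : seq nat) x : set_nth 0 c (size c) x = rcons c x.
Proof. by elim: c => //= y c ->. Qed.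

Lemma find_noleq (c : seq nat) x : (find (leq x) c < size c) = false ->
  find (leq x) c = size c.
Proof. by move/negbT; rewrite -leqNgt => h; apply/eqP; rewrite eqn_leq find_size. Qed.

Lemma new_box_pos x T : 0 < (new_box x T).1 /\ 0 < (new_box x T).2.
Proof.
elim: T x => [|c T IH] x //=; case: ifP => //= _; by case: (IH (nth 0 c (find (leq x) c))).
Qed.

Lemma size_labels w : size (labels w) = size (column w).
Proof.
rewrite /labels /column; elim/last_ind: w => [|w p IH] //.
rewrite col_run_rcons /col_step; case: ifP => kc /=; last by rewrite !size_rcons IH.
by rewrite size_set_nth_lt.
Qed.

(** A column learns of the inserted letters only through the entries bumped out of the column before
    it. Hence the insertion, defined letter by letter, can be carried out column by column. *)
Lemma bumping_col_run w : w != [::] ->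
  bumping w = (labels w :: (bumping (bumped w)).1, column w :: (bumping (bumped w)).2).
Proof.
elim/last_ind: w => [|w p IH] // _; rewrite bumping_rcons.
have [->|w0] := eqVneq w [::]; first by [].
have es := size_labels w.
rewrite (IH w0) /bumping_step /labels /column /bumped col_run_rcons /col_step /=.
move: es; rewrite -/(column w) -/(labels w) -/(bumped w) => es.
case: ifP => kc /=; last by rewrite find_noleq // set_nth_size /set_entry /= -es set_nth_size.
rewrite bumping_rcons /bumping_step /=.
set y := nth 0 _ _; have [] := new_box_pos y (bumping (bumped w)).2.
by case: (new_box _ _) => i [|j].
Qed.

Lemma count_set_nth_lt (a : pred nat) c k x : k < size c ->
  count a (set_nth 0 c k x) + a (nth 0 c k) = count a c + a x.
Proof.
by elim: c k => [|y c IH] [|k] //= kc; [lia | rewrite -addnA IH // addnA].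
Qed.

Lemma perm_col_run w : perm_eq (unzip1 w) (labels w ++ unzip1 (bumped w)) /\
  perm_eq (unzip2 w) (column w ++ unzip2 (bumped w)).
Proof.
rewrite /labels /column /bumped; elim/last_ind: w => [|w p [/permP IH1 /permP IH2]] //.
rewrite col_run_rcons /col_step; rewrite /unzip1 /unzip2 in IH1 IH2 *.
split; apply/permP => a; rewrite map_rcons -cats1 count_cat ?IH1 ?IH2 !count_cat;
  case: ifP => kc /=; rewrite ?map_rcons -!cats1 !count_cat /=; try slia.
by have := count_set_nth_lt a p.2 kc; slia.
Qed.

Lemma size_bumped w : size (column w) + size (bumped w) = size w.
Proof.
have [_ /perm_size] := perm_col_run w.
by rewrite size_cat !size_map.
Qed.

Lemma find_min c x : sorted ltn c -> find (leq x) c < size c ->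
  x <= nth 0 c (find (leq x) c) /\
  forall z, z \in c -> x <= z -> nth 0 c (find (leq x) c) <= z.
Proof.
move=> sc kc; split=> [|z zc xz]; first by apply: nth_find; rewrite has_find.
have sc' : sorted leq c by apply: sub_sorted sc => ? ?; apply: ltnW.
rewrite -[in X in _ <= X](nth_index 0 zc).
apply: (sorted_leq_nth leq_trans leqnn 0 sc'); rewrite ?inE ?index_mem //.
by rewrite leqNgt; apply/negP => /(before_find 0); rewrite nth_index // xz.
Qed.

Lemma find_noleq_lt c x : (find (leq x) c < size c) = false ->
  all (fun z => z < x) c.
Proof. by move/find_noleq => e; have := all_take_find x c; rewrite e take_size. Qed.

Lemma sorted_set_nth c x (k := find (leq x) c) :
  sorted ltn c -> k < size c -> sorted ltn (set_nth 0 c k x).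
Proof.
move=> sc kc; have [xy _] := find_min sc kc; rewrite set_nthE kc.
move: sc; rewrite -{1}(cat_take_drop k c) (drop_nth 0 kc) sorted_cat_cons => /andP[].
rewrite sorted_cat_cons !sorted_ltn_rcons all_take_find => /andP[-> _] /=.
rewrite -/k; case: (drop k.+1 c) => //= z s /andP[yz ->].
by rewrite (leq_trans _ yz).
Qed.

Lemma column_sorted w : sorted ltn (column w).
Proof.
rewrite /column; elim/last_ind: w => [|w p IH] //.
rewrite col_run_rcons /col_step; case: ifP => kc /=; first exact: sorted_set_nth.
by rewrite sorted_ltn_rcons IH find_noleq_lt.
Qed.

(** The invariant contains that the last letter is still in the column. A next letter with the same
    label is not larger, hence bumps an entry at most equal to that letter: so each label enters the
    column at most once, and the bumped entries with a common label decrease weakly. *)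
Lemma col_run_lex_rcons w p : sorted lex_rel (rcons w p) ->
  [/\ p.2 \in column (rcons w p), sorted ltn (labels (rcons w p)),
      all (leq^~ p.1) (labels (rcons w p)), sorted lex_rel (bumped (rcons w p))
    & all (lex_rel^~ p) (bumped (rcons w p))].
Proof.
elim/last_ind: w p => [|w q IH] p.
  by move=> _; rewrite /column /labels /bumped /= !inE leqnn !eqxx.
rewrite (sorted_pairwise lex_rel_trans) pairwise_rcons -(sorted_pairwise lex_rel_trans).
case/andP; rewrite all_rcons => /andP[qp _] /IH.
have := column_sorted (rcons w q); rewrite /column /labels /bumped.
rewrite [in X in _ -> _ -> X]col_run_rcons /col_step.
move: (col_run (rcons w q)) => [[D C] o] /= sC [qC sD Dq so oq].
have Dp : all (leq^~ p.1) D by apply: sub_all Dq => z /=; move: qp; rewrite /lex_rel; lia.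
have op : all (lex_rel^~ p) o by apply: sub_all oq => z zq; apply: lex_rel_trans zq qp.
case: ifP => kC /=.
  have [xy miny] := find_min sC kC.
  split=> //; first by apply/(nthP 0); exists (find (leq p.2) C);
      rewrite ?size_set_nth_lt // nth_set_nth /= eqxx.
    rewrite (sorted_pairwise lex_rel_trans) pairwise_rcons -(sorted_pairwise lex_rel_trans) so andbT.
    apply/allP => z zo; have := allP oq _ zo; move: qp; rewrite /lex_rel /=.
    by have := miny _ qC; lia.
  by rewrite all_rcons op andbT /lex_rel /=; lia.
have Cp := find_noleq_lt kC; have qp' := allP Cp _ qC.
split=> //; first by rewrite mem_rcons inE eqxx.
  rewrite sorted_ltn_rcons sD /=; apply: sub_all Dq => z zq.
  by move: qp; rewrite /lex_rel /=; lia.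
by rewrite all_rcons leqnn.
Qed.

Lemma col_run_lex w : sorted lex_rel w ->
  sorted ltn (labels w) /\ sorted lex_rel (bumped w).
Proof. by case/lastP: w => // w p /col_run_lex_rcons[]. Qed.

Lemma all_labels a w : all a (unzip1 w) -> all a (labels w) && all a (unzip1 (bumped w)).
Proof. by have [/perm_all -> _] := perm_col_run w; rewrite all_cat. Qed.

(** An entry bumped from row k of the first column lands in row k or higher in the second, where its
    left neighbour is not larger. If it is appended there, the label next to it on the left was
    recorded earlier, hence is not larger either. *)
Lemma adjacent_columns w : sorted leq (unzip1 w) ->
  col_le (column w) (column (bumped w)) /\ col_le (labels w) (labels (bumped w)).
Proof.
elim/last_ind: w => [|w p IH] //.
rewrite /unzip1 map_rcons (sorted_pairwise leq_trans) pairwise_rcons.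
rewrite -(sorted_pairwise leq_trans) => /andP[wp /IH].
have [Dp _] := andP (all_labels wp).
have := column_sorted w; have := column_sorted (bumped w).
have := size_labels w; have := size_labels (bumped w).
rewrite /column /labels /bumped !col_run_rcons /col_step in Dp *.
move: (col_run w) Dp => [[D C] o] /= Dp.
case: ifP => kC /=; last first.
  rewrite /col_le !size_rcons; move: (col_run o) => [[D2 C2] o2] /= _ _ _ _.
  case=> -[szC leC] [szD leD]; split; split; rewrite ?(leqW szC) ?(leqW szD) //.
    by move=> r rC; rewrite nth_rcons (leq_trans rC szC) leC.
  by move=> r rD; rewrite nth_rcons (leq_trans rD szD) leD.
rewrite col_run_rcons /col_step /=; move: (col_run o) => [[D2 C2] o2] /=.
move=> sDC2 sDC sC2 sC [[szC leC] [szD leD]].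
have [xy miny] := find_min sC kC.
set k := find _ _ in kC xy miny *; set y := nth 0 C k in xy miny *.
set k2 := find (leq y) C2.
(* If the second column reaches row k, its entry there is already at least y. *)
have k2k : k2 <= k.
  case: (ltnP k (size C2)) => kC2; last exact: leq_trans (find_size _ _) kC2.
  by rewrite leqNgt; apply/negP => /(before_find 0); rewrite /= leC.
have k2y : nth 0 C k2 <= y.
  apply: (sorted_leq_nth leq_trans leqnn) => //; last by rewrite inE (leq_ltn_trans k2k).
  by apply: sub_sorted sC => ? ?; apply: ltnW.
have le_set r : nth 0 (set_nth 0 C k p.2) r <= nth 0 C r.
  by rewrite nth_set_nth /=; case: eqP => [->|].
case: ifP => kC2 /=.
  split=> //; rewrite /col_le !size_set_nth_lt //; split=> // r rC2.
  apply: leq_trans (le_set r) _; rewrite [in X in _ <= X]nth_set_nth /=.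
  by case: eqP => [->|_] //; apply: leC.
have e2 : k2 = size C2 by apply: find_noleq.
rewrite /col_le !size_rcons size_set_nth_lt //.
split; split; rewrite ?sDC ?sDC2 -?e2 ?(leq_ltn_trans k2k) // => r; rewrite ltnS nth_rcons.
  rewrite -e2 => rk2; apply: leq_trans (le_set r) _.
  case: ltngtP rk2 => // [rk2|->] _ //; apply: leC; by rewrite -e2.
rewrite sDC2 -e2; case: ltngtP => // [rk2|->] _.
  by apply: leD; rewrite sDC2 -e2.
by apply: (allP Dp); rewrite mem_nth // sDC (leq_ltn_trans k2k).
Qed.

Lemma lex_rel_labels w : sorted lex_rel w -> sorted leq (unzip1 w).
Proof.
by apply: homo_sorted => p q; rewrite /lex_rel => /orP[/ltnW//|/andP[/eqP ->]].
Qed.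

Lemma bumped_lt w : w != [::] -> size (bumped w) < size w.
Proof.
case/lastP: w => // w p _; rewrite -[X in _ < X]size_bumped -[X in X < _]add0n ltn_add2r.
rewrite /column col_run_rcons /col_step; case: ifP => /=; last by rewrite size_rcons.
by move=> h; rewrite size_set_nth_lt //; apply: leq_trans h.
Qed.

(** Induction along the columns of the tableaux, [bumped w] being what the columns after the first
    receive. *)
Lemma array_ind (P : array -> Prop) : P [::] ->
  (forall w, w != [::] -> P (bumped w) -> P w) -> forall w, P w.
Proof.
move=> P0 IH w; have [m] := ubnP (size w); elim: m w => // m IHm w wm.
have [->//|w0] := eqVneq w [::]; apply: IH => //; apply: IHm.
exact: leq_trans (bumped_lt w0) wm.
Qed.

Lemma bumping_shape w : map size (bumping w).1 = map size (bumping w).2.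
Proof.
elim/array_ind: w => // w w0 IH.
by rewrite bumping_col_run //= size_labels IH.
Qed.

Lemma perm_bumping w : perm_eq (flatten (bumping w).1) (unzip1 w) /\
  perm_eq (flatten (bumping w).2) (unzip2 w).
Proof.
elim/array_ind: w => // w w0 [IH1 IH2]; rewrite bumping_col_run //=.
have [p1 p2] := perm_col_run w.
split; rewrite perm_sym; [apply: perm_trans p1 _ | apply: perm_trans p2 _];
  by rewrite perm_cat2l perm_sym.
Qed.

Lemma head_bumping w : head [::] (bumping w).1 = labels w /\
  head [::] (bumping w).2 = column w.
Proof. by have [->|w0] := eqVneq w [::]; last rewrite (bumping_col_run w0). Qed.

Lemma labels_neq0 w : w != [::] -> labels w != [::] /\ column w != [::].
Proof.
move=> w0; rewrite -!size_eq0 size_labels.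
by rewrite -lt0n -(ltn_add2r (size (bumped w))) size_bumped bumped_lt.
Qed.

Lemma tab_bumping w : sorted lex_rel w -> tab (bumping w).1 /\ tab (bumping w).2.
Proof.
elim/array_ind: w => // w w0 IH sw; have [sD so] := col_run_lex sw.
have [tT1 tT2] := IH so; have [c2 c1] := adjacent_columns (lex_rel_labels sw).
have [l0 k0] := labels_neq0 w0; have [h1 h2] := head_bumping (bumped w).
by rewrite bumping_col_run //= h1 h2; split; split=> //; apply: column_sorted.
Qed.

(** The invariant word consists of the entries bumped so far followed by the current column;
    [lat_equiv_bump] moves each newly bumped entry to the front of the column. *)
Lemma lat_equiv_col_run w : lat_equiv (unzip2 w) (unzip2 (bumped w) ++ column w).
Proof.
elim/last_ind: w => [|w p IH]; first exact: lat_equiv_refl.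
have := column_sorted w; rewrite /column /bumped col_run_rcons /col_step in IH *.
rewrite /unzip2 map_rcons; move: (col_run w) IH => [[D C] o] /= IH sC.
rewrite -cats1; apply: lat_equiv_trans (lat_equiv_cat IH (lat_equiv_refl _)) _.
rewrite -catA cats1; case: ifP => kC /=; last exact: lat_equiv_refl.
rewrite map_rcons cat_rcons; apply: lat_equiv_cat (lat_equiv_refl _) _.
exact: lat_equiv_bump.
Qed.

Lemma lat_equiv_bumping w : lat_equiv (unzip2 w) (flatten (rev (bumping w).2)).
Proof.
elim/array_ind: w => [|w w0 IH]; first exact: lat_equiv_refl.
rewrite bumping_col_run //= rev_cons flatten_rcons.
apply: lat_equiv_trans (lat_equiv_col_run w) _.
exact: lat_equiv_cat IH (lat_equiv_refl _).
Qed.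

(** * Two rows inserted into one column *)

(* M stands for the entry "bumped" when a letter is put at the bottom.         *)
Fixpoint col_insert (M : nat) (c X : seq nat) : seq nat * seq nat :=
  match X with
  | [::] => (c, [::])
  | x :: X' =>
      let k := find (leq x) c in
      let r := col_insert M (set_nth 0 c k x) X' in
      (r.1, nth M c k :: r.2)
  end.

(** Both rows are read from right to left. Entry k of S lies below entry k + e of R, so e is the
    number of boxes by which R extends beyond S on the right. *)
Definition row_below (e : nat) (R S : seq nat) : Prop :=
  forall k, k < size S -> k + e < size R -> nth 0 R (k + e) < nth 0 S k.

Lemma size_col_insert M c X : size (col_insert M c X).2 = size X.
Proof. by elim: X c => //= x X IH c; rewrite IH. Qed.

Lemma sorted_set_nth_find c x : sorted ltn c ->
  sorted ltn (set_nth 0 c (find (leq x) c) x).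
Proof.
move=> sc; case: (boolP (find (leq x) c < size c)) => [|/negbTE] kc.
  exact: sorted_set_nth.
by rewrite find_noleq // set_nth_size sorted_ltn_rcons sc find_noleq_lt.
Qed.

Lemma sorted_col_insert M c X : sorted ltn c -> sorted ltn (col_insert M c X).1.
Proof. by elim: X c => //= x X IH c sc; apply/IH/sorted_set_nth_find. Qed.

Lemma find_bump M c x : sorted ltn c -> x < M ->
  x <= nth M c (find (leq x) c) /\
  (forall z, z \in c -> x <= z -> nth M c (find (leq x) c) <= z).
Proof.
move=> sc xM; case: (boolP (find (leq x) c < size c)) => [|/negbTE] kc.
  by rewrite (set_nth_default 0) //; apply: find_min.
rewrite find_noleq // nth_default // ltnW //; split=> // z zc.
by rewrite leqNgt (allP (find_noleq_lt kc) _ zc).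
Qed.

(** Bumping as an operation on sets: x enters, the bumped entry leaves. If x goes to the bottom, the
    entry leaving is M, which is not in c, so both cases have one formula. *)
Lemma mem_set_nth_find M c x z : sorted ltn c -> all (fun y => y < M) c ->
  (z \in set_nth 0 c (find (leq x) c) x) =
  (z == x) || (z \in c) && (z != nth M c (find (leq x) c)).
Proof.
move=> sc cM; case: (boolP (find (leq x) c < size c)) => [|/negbTE] kc; last first.
  rewrite find_noleq // set_nth_size mem_rcons inE nth_default //.
  case: (boolP (z \in c)) => // zc; have := allP cM _ zc.
  by case: eqP => //= _ zM; rewrite ltn_eqF.
rewrite (set_nth_default 0) // set_nthE kc mem_cat inE.
have uc : uniq c by apply: (sorted_uniq ltn_trans ltnn).
have ec : c = take (find (leq x) c) c ++ nth 0 c (find (leq x) c) :: drop (find (leq x) c).+1 c.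
  by rewrite -drop_nth // cat_take_drop.
move: (take _ _) (nth _ _ _) (drop _ _) ec => A y B ec; subst c.
move: uc; rewrite mem_cat inE cat_uniq /= => /and4P[_ + yd _].
rewrite negb_or => /andP[yt _].
case: eqP => [->|_]; first by rewrite orbT.
case: eqP => [->|_] /=; first by rewrite (negbTE yt) (negbTE yd) andbF.
by rewrite andbT.
Qed.

Section ColInsert.

Variable M : nat.

Implicit Types c X : seq nat.

Let ok c X := [/\ sorted ltn c, all (fun y => y < M) c, sorted geq X & all (fun y => y < M) X].

Lemma ok_cons c x X : ok c (x :: X) ->
  [/\ ok (set_nth 0 c (find (leq x) c) x) X, x < M, all (leq^~ x) X
    & x \in set_nth 0 c (find (leq x) c) x].
Proof.
case=> sc cM /=; rewrite (path_sortedE (rev_trans leq_trans)) => /andP[xX sX] /andP[xM XM].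
have xc : x \in set_nth 0 c (find (leq x) c) x by rewrite (mem_set_nth_find _ _ sc cM) eqxx.
split=> //; split=> //; first exact: sorted_set_nth_find.
apply/allP => z; rewrite (mem_set_nth_find _ _ sc cM) => /predU1P[-> //|/andP[zc _]].
exact: (allP cM).
Qed.

Lemma col_insert_head_le c x X z : ok c (x :: X) -> z \in c -> x <= z ->
  nth 0 (col_insert M c (x :: X)).2 0 <= z.
Proof. by move=> h; have [_ xM _ _] := ok_cons h; case: h => sc _ _ _; apply: (find_bump sc xM).2. Qed.

Lemma col_insert_ge c X k : ok c X -> k < size X ->
  nth 0 X k <= nth 0 (col_insert M c X).2 k.
Proof.
elim: X c k => [|x X IH] c k //= h; have [h' xM _ _] := ok_cons h.
by case: k => [|k] /=; [case: h => sc _ _ _; case: (find_bump sc xM) | apply: IH].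
Qed.

(** Letter k is still in the column when letter k + 1 arrives, and it is a candidate for being
    bumped because X decreases weakly. *)
Lemma col_insert_le_prev c X k : ok c X -> k.+1 < size X ->
  nth 0 (col_insert M c X).2 k.+1 <= nth 0 X k.
Proof.
elim: X c k => [|x X IH] c k //= h; have [h' xM Xx xc] := ok_cons h.
case: k => [|k] /=; last exact: IH.
by case: X {IH} h h' Xx => //= x' X _ h' /andP[x'x _] _; apply: (col_insert_head_le h').
Qed.

(** If z has meanwhile been bumped itself, by a letter x, then everything bumped afterwards is at
    most x, hence at most z. *)
Lemma col_insert_le c X k z : ok c X -> k < size X -> z \in c -> nth 0 X k <= z ->
  nth 0 (col_insert M c X).2 k <= z.
Proof.
elim: X c k z => [|x X IH] c k z //= h; have [h' xM Xx xc] := ok_cons h.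
case: h => sc cM sX XM; have [xy miny] := find_bump sc xM.
case: k => [|k] /=; first by move=> _; apply: miny.
rewrite ltnS => kX zc Xz; have := mem_set_nth_find x z sc cM.
case: (eqVneq z (nth M c (find (leq x) c))) => [ez _|_]; last first.
  by rewrite zc /= orbT => zc'; apply: IH.
rewrite ez; apply: leq_trans xy; case: k kX {Xz} => [|k] kX.
  by apply: IH => //; exact: (allP Xx _ (mem_nth 0 kX)).
apply: leq_trans (col_insert_le_prev h' kX) _.
by apply: (allP Xx); apply: mem_nth; apply: ltnW.
Qed.

Lemma mem_col_insert c X z : ok c X -> z \in (col_insert M c X).1 -> (z \in X) || (z \in c).
Proof.
elim: X c => [|x X IH] c //= h; have [h' xM Xx xc] := ok_cons h.
case: h => sc cM sX XM /(IH _ h') /orP[zX|]; first by rewrite inE zX orbT.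
by rewrite (mem_set_nth_find _ _ sc cM) inE => /orP[->//|/andP[->]]; rewrite orbT.
Qed.

(** Later letters bump entries at most equal to the first letter x. If z was among these, z and the
    entry bumped by x would coincide, so only the first letter can remove z. *)
Lemma col_insert_stays c X z : ok c X -> z \in c -> all (leq^~ z) X ->
  z \in (col_insert M c X).1 \/ 0 < size X /\ nth 0 (col_insert M c X).2 0 = z.
Proof.
elim: X c => [|x X IH] c /= h zc; first by left.
case/andP => xz Xz; have [h' xM Xx xc] := ok_cons h.
case: h => sc cM sX XM; have [xy miny] := find_bump sc xM.
have yz := miny _ zc xz.
case: (eqVneq z (nth M c (find (leq x) c))) => [->|zy]; first by right.
have zc' : z \in set_nth 0 c (find (leq x) c) x.
  by rewrite (mem_set_nth_find _ _ sc cM) zc zy orbT.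
have [?|[X0 ez]] := IH _ h' zc' Xz; first by left.
case: X X0 ez {IH Xz} h' Xx sX XM => //= x' X _ ez h' /andP[x'x _] _ _.
have := col_insert_head_le h' xc x'x; rewrite /= ez => zx.
by have := leq_trans xy (leq_trans yz zx); move: zy; lia.
Qed.

Lemma col_insert_mem_or_bumped c X k : ok c X -> k < size X ->
  nth 0 X k \in (col_insert M c X).1 \/
  k.+1 < size X /\ nth 0 (col_insert M c X).2 k.+1 = nth 0 X k.
Proof.
elim: X c k => [|x X IH] c k //= h; have [h' xM Xx xc] := ok_cons h.
by case: k => [|k] /=; [move=> _; apply: col_insert_stays | apply: IH].
Qed.

(** The letters from k on are smaller than z, so z was in the column before letter k came. It was a
    candidate for being bumped, yet it survived. *)
Lemma col_insert_gap c X k z : ok c X -> k < size X ->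
  z \in (col_insert M c X).1 -> nth 0 X k < z -> nth 0 (col_insert M c X).2 k < z.
Proof.
elim: X c k => [|x X IH] c k //= h; have [h' xM Xx xc] := ok_cons h.
case: k => [|k] /=; last exact: IH.
move=> _ /(mem_col_insert h') zc xz; case: h => sc cM sX XM.
have [xy miny] := find_bump sc xM; move: zc.
have -> /= : (z \in X) = false by apply/negP => /(allP Xx); rewrite leqNgt xz.
rewrite (mem_set_nth_find _ _ sc cM) gtn_eqF //= => /andP[zc zy].
by rewrite ltn_neqAle eq_sym zy miny // ltnW.
Qed.

(** Among inserted letters, only the immediately preceding one can be bumped (up to equal values),
    since bumped entries are at most that letter. Only the first letter can yield M, because later
    bumped entries are at most the first letter. *)
Lemma col_insert_source c X k : ok c X -> k < size X ->
  [\/ nth 0 (col_insert M c X).2 k \in c,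
      0 < k /\ nth 0 (col_insert M c X).2 k = nth 0 X k.-1
    | k = 0 /\ nth 0 (col_insert M c X).2 k = M].
Proof.
elim: X c k => [|x X IH] c k //= h; have [h' xM Xx xc] := ok_cons h.
case: k => [|k] /= kX.
  case: (boolP (find (leq x) c < size c)) => [|/negbTE] kc; last first.
    by constructor 3; rewrite find_noleq // nth_default.
  by constructor 1; rewrite mem_nth.
have le_x : nth 0 (col_insert M (set_nth 0 c (find (leq x) c) x) X).2 k <= x.
  by apply: col_insert_le => //; apply: (allP Xx); apply: mem_nth.
have [|[k0 e]|[k0 e]] := IH _ k h' kX; last by move: xM; rewrite ltnNge -e le_x.
  case: (h) => sc cM _ _.
  rewrite (mem_set_nth_find _ _ sc cM) => /predU1P[e|/andP[? _]]; last by constructor 1.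
  constructor 2; split=> //; case: k kX e {le_x} => [|k] //= kX e.
  have := col_insert_le_prev h' kX; rewrite e.
  by have /= := allP Xx _ (mem_nth 0 (ltnW kX)); slia.
by constructor 2; case: k k0 kX e {le_x}.
Qed.

Lemma col_insert_leM c X k : ok c X -> k < size X -> nth 0 (col_insert M c X).2 k <= M.
Proof.
move=> h kX; case: (h) => sc cM sX XM.
have [zc|[k0 ->]|[_ ->//]] := col_insert_source h kX; apply: ltnW.
  exact: (allP cM).
by apply: (allP XM); rewrite mem_nth // (leq_ltn_trans _ kX) // leq_pred.
Qed.

End ColInsert.

(* An entry of R either is still in the column when S is inserted, or has been *)
(* bumped by the next entry of R; in both cases it bounds from above an entry  *)
(* bumped by S. In the second case S needs a next entry as well, which is what *)
(* the last hypothesis provides: without it the converse fails.                *)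
Lemma row_below_col_insert M M' c R S e :
  M < M' -> sorted ltn c -> all (fun y => y < M) c ->
  sorted geq R -> all (fun y => y < M) R -> sorted geq S -> all (fun y => y < M) S ->
  size R <= e + size S ->
  let r := col_insert M c R in
  row_below e R S <-> row_below e r.2 (col_insert M' r.1 S).2.
Proof.
move=> MM' sc cM sR RM sS SM szR r.
have okR : [/\ sorted ltn c, all (fun y => y < M) c, sorted geq R & all (fun y => y < M) R].
  by [].
have okS : [/\ sorted ltn r.1, all (fun y => y < M') r.1, sorted geq S & all (fun y => y < M') S].
  split=> //; first exact: sorted_col_insert.
    apply/allP => z /(mem_col_insert okR) /orP[/(allP RM)|/(allP cM)] zM; exact: ltn_trans zM MM'.
  by apply: sub_all SM => z zM; apply: ltn_trans zM MM'.
rewrite /row_below !size_col_insert; split=> H k kS kR.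
  rewrite ltnNge; apply/negP => le.
  have S_le := col_insert_ge okS kS.
  (* An entry bumped by S either was left in the column by R, and [col_insert_gap] applies; or it is
     the preceding letter of S, and the inequality one place earlier applies; or it is M', which
     exceeds all that R bumps. *)
  have [zc|[k0 e1]|[k0 e1]] := col_insert_source okS kS.
  - have := col_insert_gap okR kR zc (leq_trans (H k kS kR) S_le).
    by rewrite ltnNge le.
  - case: k kS kR le {S_le} k0 e1 => // k kS kR le _ /= e1.
    have := H k (ltnW kS) (ltnW kR); rewrite -e1 ltnNge => /negP; apply.
    apply: leq_trans le _; exact: col_insert_le_prev.
  - have := col_insert_leM okR kR; rewrite leqNgt => /negP; apply.
    by apply: leq_trans le; rewrite e1.
rewrite ltnNge; apply/negP => le.
have [zc|[kR' e1]] := col_insert_mem_or_bumped okR kR.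
  have := H k kS kR; rewrite ltnNge => /negP; apply.
  by apply: leq_trans (col_insert_le okS kS zc le) (col_insert_ge okR kR).
have kS' : k.+1 < size S by lia.
have := H k.+1 kS' kR'; rewrite addSn e1 ltnNge => /negP; apply.
exact: leq_trans (col_insert_le_prev okS kS') le.
Qed.

(** * The recording tableau *)

Definition row_word (i : nat) (w : array) : seq nat := [seq p.2 | p <- w & p.1 == i].

(* Rows i and i + 1 (both read from right to left) of a skew filling whose row *)
(* i starts d columns to the right of row i + 1: row i + 1 ends weakly to the  *)
(* left of row i and the entries increase strictly down the columns.           *)
Definition rows_strict (d : nat) (R S : seq nat) : Prop :=
  size S <= d + size R /\ row_below (d + size R - size S) R S.

Lemma size_row_word i w : size (row_word i w) = count_mem i (unzip1 w).
Proof. by rewrite size_map size_filter count_map. Qed.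

Lemma row_word_sorted i w : sorted lex_rel w -> sorted geq (row_word i w).
Proof.
move=> sw; have : sorted lex_rel [seq p <- w | p.1 == i].
  exact: sorted_filter lex_rel_trans _ _ sw.
have := filter_all (fun p => p.1 == i) w.
rewrite /row_word; elim: (filter _ _) => //= p s IH /andP[pi si].
case: s si IH => //= q s /andP[qi si] IH /andP[pq sq]; rewrite IH ?qi //.
by move: pq; rewrite /lex_rel (eqP pi) (eqP qi) ltnn eqxx /= => ->.
Qed.

Lemma split_labels b (w : array) : sorted leq (unzip1 w) ->
  w = [seq p <- w | p.1 < b] ++ [seq p <- w | b <= p.1].
Proof.
elim: w => //= p w IH; rewrite (path_sortedE leq_trans) => /andP[pw /IH e].
case: (ltnP p.1 b) => pb /=; first by rewrite -e.
have -> : [seq p <- w | p.1 < b] = [::].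
  rewrite (eq_in_filter (a2 := pred0)) ?filter_pred0 // => q qw; apply/negbTE.
  by rewrite -leqNgt (leq_trans pb) // (allP pw) // map_f.
rewrite (eq_in_filter (a2 := predT)) ?filter_predT // => q qw.
by rewrite (leq_trans pb) // (allP pw) // map_f.
Qed.

Lemma map_row_word i (w : array) : [seq (i, x) | x <- row_word i w] = [seq p <- w | p.1 == i].
Proof.
rewrite /row_word -map_comp; have := filter_all (fun p => p.1 == i) w.
by elim: (filter _ _) => //= [[j x] s IH] /andP[/= /eqP -> /IH ->].
Qed.

Lemma split_row_words i (w : array) : sorted leq (unzip1 w) ->
  w = [seq p <- w | p.1 < i] ++ [seq (i, x) | x <- row_word i w] ++
      [seq (i.+1, x) | x <- row_word i.+1 w] ++ [seq p <- w | i.+1 < p.1].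
Proof.
move=> sw; rewrite !map_row_word {1}(split_labels i sw); congr (_ ++ _).
have s1 b : sorted leq (unzip1 [seq p <- w | b <= p.1]).
  apply: (subseq_sorted leq_trans _ sw); apply: map_subseq; exact: filter_subseq.
rewrite (split_labels i.+1 (s1 i)) -!filter_predI; congr (_ ++ _).
  by apply: eq_filter => p /=; lia.
rewrite [LHS](_ : _ = [seq p <- w | i < p.1]); last by apply: eq_filter => p /=; lia.
rewrite {1}(split_labels i.+2 (s1 i.+1)) -!filter_predI.
by congr (_ ++ _); apply: eq_filter => p /=; lia.
Qed.

Definition run_from st (w : array) := foldl col_step st w.

Lemma run_from_other i w st : all (fun p => p.1 != i) w ->
  row_word i (run_from st w).2 = row_word i st.2 /\
  (i \in (run_from st w).1.1) = (i \in st.1.1).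
Proof.
elim: w st => //= p w IH st /andP[pi wi]; have [-> ->] := IH (col_step st p) wi.
rewrite /col_step; case: ifP => _ //=.
  by rewrite /row_word filter_rcons /= (negbTE pi).
by rewrite mem_rcons inE eq_sym (negbTE pi).
Qed.

Definition appends (c X : seq nat) : bool :=
  if X is x :: _ then size c <= find (leq x) c else false.

(** Returning from [col_insert] to [col_step] means dropping the fictitious M. Only the first letter
    of X can produce it: every later one finds its predecessor in the column and bumps. *)
Lemma run_from_row M b st X : sorted geq X ->
  let r := col_insert M st.1.2 X in
  let a := appends st.1.2 X in
  [/\ (run_from st [seq (b, x) | x <- X]).1.2 = r.1,
      row_word b (run_from st [seq (b, x) | x <- X]).2 =
        row_word b st.2 ++ (if a then behead r.2 else r.2)
    & (b \in (run_from st [seq (b, x) | x <- X]).1.1) = (b \in st.1.1) || a].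
Proof.
elim: X st => [|x X IH] st sX /=; first by rewrite cats0 orbF.
have := IH (col_step st (b, x)) (path_sorted sX).
have na : appends (col_step st (b, x)).1.2 X = false.
  case: X sX {IH} => //= x' X /andP[x'x _].
  apply/negbTE; rewrite -ltnNge -has_find; apply/hasP; exists x => //.
  rewrite /col_step /=; case: ifP => kc /=; last by rewrite mem_rcons inE eqxx.
  by apply/(nthP 0); exists (find (leq x) st.1.2);
    rewrite ?size_set_nth_lt // nth_set_nth /= eqxx.
rewrite na /= => -[-> -> ->]; rewrite orbF.
rewrite /col_step /=; case: ltnP => kc /=.
  rewrite orbF /row_word filter_rcons /= eqxx map_rcons /= cat_rcons.
  by rewrite (set_nth_default 0).
have ek : find (leq x) st.1.2 = size st.1.2 by apply/eqP; rewrite eqn_leq find_size.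
by rewrite ek set_nth_size mem_rcons inE eqxx orbT.
Qed.

Lemma appends_head M c X : appends c X -> (col_insert M c X).2 = M :: behead (col_insert M c X).2.
Proof. by case: X => //= x X h; rewrite nth_default. Qed.

Lemma lattice_strict i h D : sorted ltn D ->
  lattice i h D = (i.+1 \in D) ==> ((i \in D) || (0 < h)).
Proof.
elim: D h => //= x D IH h; rewrite (path_sortedE ltn_trans) => /andP[xD sD].
have lt z : z \in D -> x < z by apply: (allP xD).
rewrite !inE !IH //; case: (eqVneq x i) => [<-|xi].
  by rewrite /= ?orbT !implybT.
case: (eqVneq x i.+1) => [e|xi'].
  have -> : (i.+1 \in D) = false by apply/negP => /lt; rewrite e ltnn.
  have -> : (i \in D) = false by apply/negP => /lt; rewrite e ltnNge leqnSn.
  by rewrite /= andbT.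
by [].
Qed.

(** The fictitious entries M and M' sit at the right ends of the two rows. Deleting just one of them
    shifts the alignment by one, and the extra condition on the right is what a lattice word
    requires when label i + 1 is recorded in this column: a label i there as well, or a surplus from
    the columns to its right. *)
Lemma rows_strict_behead d M M' R S R' S' (a b : bool) : M < M' ->
  R' = (if a then M :: R else R) -> S' = (if b then M' :: S else S) ->
  (forall k, k < size R' -> nth 0 R' k <= M) ->
  (~~ b -> 0 < size S' -> nth 0 S' 0 < M) ->
  rows_strict d R' S' <->
  rows_strict d R S /\ (b ==> (a || (0 < d + size R - size S))).
Proof.
move=> MM' eR eS leM S0; rewrite /rows_strict /row_below.
case: a eR => eR; case: b eS S0 => eS S0; rewrite eR eS /= in leM S0 *.
- rewrite addnS ltnS subSS; split=> [[le H]|[[le H] _]]; do !split=> //.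
    by move=> k kS kR; apply: (H k.+1); rewrite ?addSn ?ltnS.
  case=> [|k] kS kR; last exact: H.
  by apply: leq_ltn_trans MM'; apply: leM.
- rewrite ?implyFb; split=> [[le H]|[[le H] _]].
    (* Otherwise the offset would be 0 and M would stand above the first entry of S', which is
       smaller than M. *)
    have lt : size S <= d + size R.
      case: (posnP (size S)) => [->//|S1]; rewrite leqNgt; apply/negP => lt.
      have e0 : d + (size R).+1 - size S = 0 by lia.
      by have := H 0 S1; rewrite e0 /= => /(_ isT); have := S0 isT S1; lia.
    do !split=> //; move=> k kS kR; have := H k kS; rewrite addnS subSn // addnS /=.
    by apply.
  split; first by lia.
  move=> k kS; rewrite addnS subSn // addnS /= ltnS; exact: H.
- split=> [[le H]|[[le H] lt]].
    do !split; [lia| |lia] => k kS kR.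
    have -> : k + (d + size R - size S) = k.+1 + (d + size R - (size S).+1) by lia.
    by apply: (H k.+1) => //; lia.
  split; first lia.
  case=> [|k] kS kR; first by apply: leq_ltn_trans MM'; apply: leM.
  have -> : k.+1 + (d + size R - (size S).+1) = k + (d + size R - size S) by lia.
  by apply: H => //; lia.
by rewrite ?implyFb; split=> [|[]].
Qed.

(** Letters with labels below i only prepare the column, and those with labels above i + 1 come too
    late to affect rows i and i + 1. What remains are two consecutive decreasing words, to which
    [row_below_col_insert] applies; the labels left in the column account for the words becoming
    shorter. *)
Lemma rows_strict_bumped d i w : sorted lex_rel w ->
  rows_strict d (row_word i w) (row_word i.+1 w) <->
  rows_strict d (row_word i (bumped w)) (row_word i.+1 (bumped w)) /\
  lattice i (d + size (row_word i (bumped w)) - size (row_word i.+1 (bumped w))) (labels w).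
Proof.
move=> sw; have [sD so] := col_run_lex sw; rewrite lattice_strict //.
have sR := row_word_sorted i sw; have sS := row_word_sorted i.+1 sw.
have := split_row_words i (lex_rel_labels sw).
set R := row_word i w in sR *; set S := row_word i.+1 w in sS *.
set u := filter _ w; set t := filter _ w => ew.
have uP j : i <= j -> all (fun p => p.1 != j) u.
  move=> ij; apply/allP => p; rewrite mem_filter => /andP[pi _].
  by rewrite ltn_eqF // (leq_trans pi).
have tP j : j <= i.+1 -> all (fun p => p.1 != j) t.
  move=> ij; apply/allP => p; rewrite mem_filter => /andP[pi _].
  by rewrite gtn_eqF // (leq_ltn_trans ij).
have blkP (j k : nat) (X : seq nat) : k != j -> all (fun p => p.1 != j) [seq (k, x) | x <- X].
  by move=> kj; rewrite all_map; apply/allP.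
have i1 : i.+1 != i by rewrite gtn_eqF.
have i2 : i != i.+1 by rewrite ltn_eqF.
(* M stands for the bottom of the column when R is inserted, and [M.+1] when S is, so that an append
   by S dominates everything bumped by R. *)
pose M := (\max_(x <- column u ++ R ++ S) x).+1.
have ltM x : x \in column u ++ R ++ S -> x < M.
  by move=> xin; rewrite ltnS; apply: leq_bigmax_seq.
have cM : all (fun y => y < M) (column u).
  by apply/allP => x xc; apply: ltM; rewrite mem_cat xc.
have RM : all (fun y => y < M) R.
  by apply/allP => x xc; apply: ltM; rewrite !mem_cat xc orbT.
have SM : all (fun y => y < M) S.
  by apply/allP => x xc; apply: ltM; rewrite !mem_cat xc !orbT.
set st0 := col_run u; set st1 := run_from st0 [seq (i, x) | x <- R].
set st2 := run_from st1 [seq (i.+1, x) | x <- S].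
have e3 : col_run w = run_from st2 t by rewrite ew /col_run !foldl_cat.
have sc := column_sorted u; rewrite /column -/st0 in sc cM.
have [o0i D0i] := run_from_other ([::], [::], [::]) (uP i (leqnn i)).
have [o0j D0j] := run_from_other ([::], [::], [::]) (uP i.+1 (leqnSn i)).
rewrite -[run_from _ u]/(col_run u) -/st0 /= in o0i D0i o0j D0j.
have [c1 o1i D1i] := run_from_row M i st0 sR.
have [o1j D1j] := run_from_other st0 (blkP _ _ R i2).
rewrite -/st1 in c1 o1i D1i o1j D1j.
have [c2 o2j D2j] := run_from_row M.+1 i.+1 st1 sS.
have [o2i D2i] := run_from_other st1 (blkP _ _ S i1).
rewrite -/st2 in c2 o2j D2j o2i D2i.
have [o3i D3i] := run_from_other st2 (tP i (leqnSn i)).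
have [o3j D3j] := run_from_other st2 (tP i.+1 (leqnn _)).
rewrite -e3 in o3i D3i o3j D3j.
rewrite /bumped /labels o3i o2i o1i o0i o3j o2j o1j o0j D3i D2i D1i D0i D3j D2j D1j D0j.
rewrite c1 /= {c1 c2 o0i D0i o0j D0j o1i D1i o1j D1j o2j D2j o2i D2i o3i D3i o3j D3j}.
have okR : [/\ sorted ltn st0.1.2, all (fun y => y < M) st0.1.2, sorted geq R & all (fun y => y < M) R].
  by [].
have crux := row_below_col_insert (ltnSn M) sc cM sR RM sS SM.
set R' := (col_insert M _ R).2 in crux *; set c1 := (col_insert M _ R).1 in crux *.
set S' := (col_insert M.+1 _ S).2 in crux *.
have szR : size R' = size R by apply: size_col_insert.
have szS : size S' = size S by apply: size_col_insert.
set a := appends _ R; set b := appends _ S.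
have aR : a -> R' = M :: behead R' by apply: appends_head.
have bS : b -> S' = M.+1 :: behead S' by apply: appends_head.
have leM k : k < size R -> nth 0 R' k <= M by apply: col_insert_leM okR.
have S0 : ~~ b -> 0 < size S -> nth 0 S' 0 < M.
  rewrite /S' /b; case: (S) => //= x S1; rewrite -ltnNge => kc _.
  rewrite (set_nth_default 0) //; have /(mem_col_insert okR) := mem_nth 0 kc.
  by case/orP; [apply: (allP RM) | apply: (allP cM)].
(* The inequality between sizes in [rows_strict] makes the offset an honest difference and so yields
   the size hypothesis of [crux]. *)
have -> : rows_strict d R S <-> rows_strict d R' S'.
  rewrite /rows_strict szR szS.
  by split=> -[le Hb]; split=> //; apply/crux => //; rewrite subnK // leq_addl.
refine (@rows_strict_behead d M M.+1 _ _ R' S' a b (ltnSn M) _ _ _ _); rewrite ?szR ?szS //.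
- by case: (a) aR => // ->.
- by case: (b) bS => // ->.
Qed.

(** The columns are read from right to left, so the labels of the first column come last; by
    [lattice_cat] they face the surplus d plus the number of labels i minus that of labels i + 1 in
    the bumped array, as in [rows_strict_bumped]. *)
Lemma lattice_bumping_labels d i w : sorted lex_rel w ->
  lattice i d (flatten (rev (bumping w).1)) <->
  rows_strict d (row_word i w) (row_word i.+1 w).
Proof.
elim/array_ind: w => [_|w w0 IH sw]; first by split.
have [_ so] := col_run_lex sw; rewrite rows_strict_bumped // -IH // bumping_col_run //=.
rewrite rev_cons flatten_rcons lattice_cat.
have cnt j : count_mem j (flatten (rev (bumping (bumped w)).1)) = size (row_word j (bumped w)).
  rewrite size_row_word -(permP (perm_bumping (bumped w)).1).
  have /permP -> // : perm_eq (flatten (rev (bumping (bumped w)).1))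
                              (flatten (bumping (bumped w)).1).
  by apply: perm_flatten; rewrite perm_rev.
by rewrite !cnt; split=> [/andP|/andP].
Qed.

(** * Reverse bumping *)

Lemma last_filter_iota (P : pred nat) n k : k < n -> P k ->
  (forall k', k < k' < n -> ~~ P k') -> last 0 [seq j <- iota 0 n | P j] = k.
Proof.
move=> kn Pk nP; rewrite -(subnKC kn) iotaD filter_cat.
have -> : [seq j <- iota (0 + k.+1) (n - k.+1) | P j] = [::].
  rewrite (eq_in_filter (a2 := pred0)) ?filter_pred0 // => j.
  by rewrite mem_iota add0n subnKC // => h; apply/negbTE/nP.
by rewrite cats0 -addn1 iotaD filter_cat /= add0n Pk last_cat.
Qed.

Lemma last_leq_nth c y k : sorted ltn c -> k < size c -> nth 0 c k <= y ->
  (k.+1 < size c -> y < nth 0 c k.+1) ->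
  last 0 [seq j <- iota 0 (size c) | nth 0 c j <= y] = k.
Proof.
move=> sc kc ck yc; apply: last_filter_iota => // j /andP[kj jc].
rewrite -ltnNge; have kc' := leq_ltn_trans kj jc; apply: leq_trans (yc kc') _.
have sc' : sorted leq c by apply: sub_sorted sc => ? ?; apply: ltnW.
exact: (sorted_leq_nth leq_trans leqnn 0 sc').
Qed.

Lemma tab_columns_neq0 T : tab T -> all (fun c => c != [::]) T.
Proof. by elim: T => //= c T IH [_ -> _ /IH]. Qed.

Lemma rev_bump_cons c T i j : c != [::] ->
  rev_bump (c :: T) (i, j.+2) =
  let r := rev_bump T (i, j.+1) in
  let k := last 0 [seq k <- iota 0 (size c) | nth 0 c k <= r.2] in
  (set_nth 0 c k r.2 :: r.1, nth 0 c k).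
Proof. by move=> c0; rewrite /rev_bump /del_box /entry /= c0. Qed.

Lemma rev_bump_head c T i : tab T ->
  rev_bump (c :: T) (i.+1, 1) =
  (if take i c == [::] then T else take i c :: T, nth 0 c i).
Proof.
move=> /tab_columns_neq0 /all_filterP e; rewrite /rev_bump /del_box /entry /= drop0.
by case: eqP => [->|] /=; rewrite e.
Qed.

(** After x has replaced y in row k, the entry below is larger than y, so row k is the bottommost
    one with an entry at most y. *)
Lemma col_bumpK T x : tab T -> rev_bump (col_bump x T) (new_box x T) = (T, x).
Proof.
elim: T x => [|c T IH] x //= [sc c0 cc tT].
case: ifP => kc /=; last first.
  rewrite find_noleq // set_nth_size rev_bump_head // -cats1 take_size_cat //.
  by rewrite (negbTE c0) nth_cat ltnn subnn.
set k := find _ _ in kc *; set y := nth 0 c k.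
have [] := new_box_pos y T; have := IH y tT.
case: (new_box y T) => i [|j] //= IHy _ _.
have nk r : nth 0 (set_nth 0 c k x) r = if r == k then x else nth 0 c r.
  by rewrite nth_set_nth.
rewrite rev_bump_cons; last by rewrite -size_eq0 size_set_nth_lt // -lt0n (leq_trans _ kc).
rewrite IHy /= (@last_leq_nth _ _ k) ?nk ?eqxx ?size_set_nth_lt //.
- by rewrite set_set_nth eqxx; congr (_ :: _, _); apply: (@eq_from_nth _ 0) => [|r _];
    [rewrite size_set_nth_lt | rewrite nth_set_nth /=; case: eqP => [->|]].
- exact: sorted_set_nth.
- by have [] := find_min sc kc.
- by move=> kc'; rewrite gtn_eqF //; apply: (sorted_ltn_nth ltn_trans 0 sc).
Qed.

Lemma find_eq c x k : k < size c -> x <= nth 0 c k ->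
  (forall r, r < k -> nth 0 c r < x) -> find (leq x) c = k.
Proof.
move=> kc xc lt; apply/eqP; rewrite eqn_leq; apply/andP; split.
  by rewrite leqNgt; apply/negP => /(before_find 0); rewrite xc.
rewrite leqNgt; apply/negP => /lt; rewrite ltnNge => /negP; apply.
by apply: nth_find; apply/(has_nthP 0); exists k.
Qed.

(** The hypotheses on sizes say that the box is a corner. The last two conclusions carry the
    induction: they relate the bumped entry and the new first column to the column on the left. *)
Lemma rev_bumpK T i j (r := rev_bump T (i.+1, j.+1)) :
  tab T -> size (nth [::] T j) = i.+1 -> size (nth [::] T j.+1) <= i ->
  [/\ tab r.1, col_bump r.2 r.1 = T, new_box r.2 r.1 = (i.+1, j.+1),
      r.2 \in head [::] T & col_le (head [::] T) (head [::] r.1)].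
Proof.
rewrite {}/r; elim: T j => [|c T IH] j; first by rewrite nth_nil.
case=> sc c0 cc tT; case: j => [|j] ej ej1; rewrite /= in ej ej1.
  rewrite rev_bump_head //; set x := nth 0 c i.
  have ic : i < size c by rewrite ej.
  have xc : x \in c by rewrite mem_nth.
  case: eqP => [/(congr1 size)/= e0|t0] /=.
    have i0 : i = 0 by move: e0; rewrite size_takel // ltnW.
    have T0 : T = [::].
      by case: (T) tT ej1 => //= d T' [_ + _ _]; rewrite -size_eq0 i0; case: size.
    by rewrite /x T0 i0; case: (c) ej; rewrite i0 //= => z [] //=; rewrite inE eqxx.
  have st : sorted ltn (take i c) /\ all (fun z => z < x) (take i c).
    apply/andP; rewrite -sorted_ltn_rcons -take_nth //.
    by rewrite take_sorted.
  have [st1 st2] := st.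
  have szt : size (take i c) = i by rewrite size_takel // ltnW.
  have fe : find (leq x) (take i c) = i.
    rewrite -[RHS]szt; apply: find_noleq; apply/negbTE; rewrite -has_find -all_predC.
    by apply: sub_all st2 => z /=; rewrite -ltnNge.
  have le : col_le c (take i c).
    by split=> [|r]; rewrite szt; [exact: ltnW | move=> ri; rewrite nth_take].
  split=> //.
  - split=> //; first exact/eqP.
    split; first by rewrite -nth0 szt.
    by move=> r rT; rewrite nth_take ?cc.2 // (leq_trans rT) // -nth0.
  - rewrite fe szt ltnn -[X in set_nth _ _ X]szt set_nth_size -take_nth //.
    by rewrite -ej take_size.
  - by rewrite fe szt ltnn.
have := IH j tT ej ej1; rewrite rev_bump_cons //.
case: (rev_bump T (i.+1, j.+1)) => T' y /= [tT' eT eb yT leT].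
have [sT tT0] : sorted ltn (head [::] T) /\ head [::] T != [::].
  by case: (T) tT ej => [|d T1] /=; [rewrite nth_nil | case].
(* The row just above the first entry larger than y, that is, the bottommost row with an entry at
   most y. It exists because the top of c is at most the top of the next column, which is at most
   y. *)
set k := (find (ltn y) c).-1.
have f0 : 0 < find (ltn y) c.
  have h0 : 0 < size (head [::] T) by rewrite lt0n size_eq0.
  have : nth 0 c 0 <= y.
    apply: leq_trans (cc.2 0 h0) _; rewrite -(nth_index 0 yT).
    apply: (sorted_leq_nth leq_trans leqnn) => //; last by rewrite inE index_mem.
    by apply: sub_sorted sT => ? ?; apply: ltnW.
  by case: (c) c0 => //= z s _; rewrite leqNgt => /negbTE ->.
have kf : k.+1 = find (ltn y) c by rewrite prednK.
have kc : k < size c by rewrite kf find_size.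
have ky : nth 0 c k <= y by rewrite leqNgt; apply/negbT/(before_find 0); rewrite -kf.
have yk : k.+1 < size c -> y < nth 0 c k.+1.
  by rewrite kf => h; apply: nth_find; rewrite has_find.
rewrite (last_leq_nth sc kc ky yk).
have nk r : nth 0 (set_nth 0 c k y) r = if r == k then y else nth 0 c r.
  by rewrite nth_set_nth.
have fk : find (leq (nth 0 c k)) (set_nth 0 c k y) = k.
  apply: find_eq; rewrite ?size_set_nth_lt ?nk ?eqxx // => r rk.
  by rewrite nk ltn_eqF // (sorted_ltn_nth ltn_trans 0 sc) ?inE // (ltn_trans rk).
have le : col_le c (set_nth 0 c k y).
  by split=> [|r _]; rewrite ?size_set_nth_lt ?nk //; case: eqP => [->|].
rewrite fk size_set_nth_lt // kc nk eqxx eT eb mem_nth //; split=> //.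
- split=> //.
  + apply/(sortedP 0) => r; rewrite size_set_nth_lt // => rc; rewrite !nk.
    have lt := sortedP 0 sc r rc; case: (eqVneq r k) => [er|_].
      by subst r; rewrite gtn_eqF //; apply: yk.
    by case: eqP => [e|//]; apply: (leq_trans _ ky); rewrite -e.
  + by rewrite -size_eq0 size_set_nth_lt // size_eq0.
  split; rewrite ?size_set_nth_lt //; first by rewrite (leq_trans leT.1 cc.1).
  move=> r rT'; rewrite nk; case: eqP => [e|_]; last first.
    exact: leq_trans (cc.2 _ (leq_trans rT' leT.1)) (leT.2 _ rT').
  (* In row k, y must not exceed its new right neighbour. It suffices that y stood in row k or
     higher of the old next column. Had it stood lower, the entry of c in row k + 1 would be at most
     y, against the choice of k. *)
  rewrite e in rT' *; apply: (leq_trans _ (leT.2 _ rT')); have kT := leq_trans rT' leT.1.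
  rewrite -(nth_index 0 yT); have mT : index y (head [::] T) < size (head [::] T) by rewrite index_mem.
  apply: (sorted_leq_nth leq_trans leqnn) => //.
    by apply: sub_sorted sT => ? ?; apply: ltnW.
  rewrite leqNgt; apply/negP => km; have := yk (leq_ltn_trans km (leq_trans mT cc.1)).
  rewrite ltnNge -{1}(nth_index 0 yT) => /negP; apply.
  apply: (leq_trans _ (cc.2 _ mT)); apply: (sorted_leq_nth leq_trans leqnn) => //.
  - by apply: sub_sorted sc => ? ?; apply: ltnW.
  - by rewrite inE (leq_ltn_trans km) // (leq_trans mT cc.1).
  by rewrite inE (leq_trans mT cc.1).
- by rewrite set_set_nth eqxx; congr (_ :: _); apply: (@eq_from_nth _ 0) => [|r _];
    [rewrite size_set_nth_lt | rewrite nth_set_nth /=; case: eqP => [->|]].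
Qed.

(** Since a is in the first column when a' arrives, a' bumps an entry at most a, hence at most the
    entry bumped by a; the same comparison holds in the next column. *)
Lemma new_box_right T a a' : tab T -> a' <= a ->
  (new_box a T).2 < (new_box a' (col_bump a T)).2.
Proof.
elim: T a a' => [|c T IH] a a' /=.
  by move=> _ le; rewrite le /=.
case=> sc c0 cc tT le; have sc' := sorted_set_nth_find a sc.
case: ifP => kc /=.
  set k := find _ _ in kc sc' *; set y := nth 0 c k; set c' := set_nth _ _ _ _ in sc' *.
  have ac : a \in c'.
    by apply/(nthP 0); exists k; rewrite ?size_set_nth_lt // nth_set_nth /= eqxx.
  have k'c : find (leq a') c' < size c' by rewrite -has_find; apply/hasP; exists a.
  have [_ miny] := find_min sc' k'c; rewrite k'c /= !ltnS; apply: IH => //.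
  by apply: leq_trans (miny _ ac le) _; have [] := find_min sc kc.
rewrite (find_noleq kc) set_nth_size.
have k'c : find (leq a') (rcons c a) < size (rcons c a).
  by rewrite -has_find has_rcons le.
by rewrite k'c /= ltnS; case: (new_box_pos (nth 0 (rcons c a) (find (leq a') (rcons c a))) T).
Qed.

(** The letter a' acts strictly below a: it bumps a larger entry than a did, or stops in this
    column. *)
Lemma new_box_left T a a' : tab T -> a < a' ->
  (new_box a' (col_bump a T)).2 <= (new_box a T).2.
Proof.
elim: T a a' => [|c T IH] a a' /=.
  by move=> _ lt; rewrite [a' <= a]leqNgt lt.
case=> sc c0 cc tT lt; have sc' := sorted_set_nth_find a sc.
case kc: (find (leq a) c < size c) => /=; last first.
  rewrite (find_noleq kc) set_nth_size; have lt_c := find_noleq_lt kc.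
  have -> : find (leq a') (rcons c a) = size (rcons c a).
    apply: find_noleq; apply/negbTE; rewrite -has_find has_rcons [a' <= a]leqNgt lt /= -all_predC.
    by apply: sub_all lt_c => z za /=; rewrite -ltnNge (ltn_trans za lt).
  by rewrite ltnn.
set k := find _ _ in kc sc' *; set y := nth 0 c k; set c' := set_nth _ _ _ _ in sc' *.
case: ifP => //= k'c; rewrite ltnS; apply: IH => //.
have [le' _] := find_min sc' k'c; set k' := find _ _ in k'c le' *.
have kk' : k < k'.
  rewrite ltnNge; apply/negP => k'k.
  have : nth 0 c' k' <= nth 0 c' k.
    apply: (sorted_leq_nth leq_trans leqnn) => //; last by rewrite inE size_set_nth_lt.
    by apply: sub_sorted sc' => ? ?; apply: ltnW.
  by rewrite [X in _ <= X]nth_set_nth /= eqxx leqNgt (leq_trans lt le').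
rewrite /c' nth_set_nth /= gtn_eqF //; apply: (sorted_ltn_nth ltn_trans 0 sc) => //.
by move: k'c; rewrite size_set_nth_lt.
Qed.

Lemma new_box_addable x T :
  exists2 j, j <= size T & new_box x T = ((size (nth [::] T j)).+1, j.+1).
Proof.
elim: T x => [|c T IH] x /=; first by exists 0.
case: ifP => kc; last by exists 0.
by have [j jT ->] := IH (nth 0 c (find (leq x) c)); exists j.+1.
Qed.

Lemma set_entry_addable T j z :
  set_entry T ((size (nth [::] T j)).+1, j.+1) z = set_nth [::] T j (rcons (nth [::] T j) z).
Proof. by rewrite /set_entry /= set_nth_size. Qed.

Lemma perm_flatten_set_entry (T : columns) j z : j <= size T ->
  perm_eq (flatten (set_nth [::] T j (rcons (nth [::] T j) z))) (z :: flatten T).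
Proof.
elim: T j => [|c T IH] [|j] //= jT.
  by rewrite -cats1 -catA /= -cat_rcons -cats1 perm_catAC perm_catC.
apply: perm_trans (perm_cat (perm_refl c) (IH j jT)) _.
by rewrite -cat_rcons -cats1 -catA perm_catCA.
Qed.

Lemma del_box_set_nth T j z : all (fun c => c != [::]) T -> j <= size T ->
  del_box (set_nth [::] T j (rcons (nth [::] T j) z)) ((size (nth [::] T j)).+1, j.+1) = T.
Proof.
move=> /all_filterP T0 jT; rewrite /del_box /= nth_set_nth /= eqxx -cats1 take_size_cat //.
rewrite cats1 set_set_nth eqxx; move: jT; rewrite leq_eqVlt => /predU1P[->|jT].
  have -> : set_nth [::] T (size T) (nth [::] T (size T)) = rcons T [::].
    by rewrite nth_default //; elim: (T) => //= c s ->.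
  by rewrite filter_rcons /= T0.
rewrite -[RHS]T0; congr filter; apply: (@eq_from_nth _ [::]).
  by rewrite size_set_nth; apply/maxn_idPr.
by move=> r _; rewrite nth_set_nth /=; case: eqP => [->|].
Qed.

Lemma nth_col_lt (T : columns) j x : x \in nth [::] T j -> j < size T.
Proof. by move=> h; rewrite ltnNge; apply/negP => h'; rewrite nth_default in h. Qed.

Lemma mem_flatten_col (T : columns) j x : x \in nth [::] T j -> x \in flatten T.
Proof. by move=> h; apply/flattenP; exists (nth [::] T j) => //; apply/mem_nth/nth_col_lt/h. Qed.

Lemma max_boxE T m i j : tab T -> all (leq^~ m) (flatten T) ->
  size (nth [::] T j) = i.+1 -> nth 0 (nth [::] T j) i = m ->
  (forall j', j < j' -> m \notin nth [::] T j') -> max_box T = (i.+1, j.+1).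
Proof.
move=> tT le sz em last; have mj : m \in nth [::] T j by rewrite -em mem_nth // sz.
rewrite /max_box; have -> : \max_(x <- flatten T) x = m.
  apply/eqP; rewrite eqn_leq; apply/andP; split.
    by apply/bigmax_leqP_seq => x xT _; apply: (allP le).
  by apply: leq_bigmax_seq => //; apply: mem_flatten_col mj.
have jT := nth_col_lt mj.
rewrite (@last_filter_iota _ _ j) // => [|k' /andP[jk _]]; last exact: last.
have /tab_nth/(_ _ jT)[sc _ _] := tT.
by rewrite -em index_uniq ?sz // (sorted_uniq ltn_trans ltnn).
Qed.

(** The right-most maximal entry is at the bottom of its column by strictness. The next column is
    shorter, since a right neighbour would have to be maximal too. So the box is a corner. *)
Lemma max_box_exists T : tab T -> T != [::] -> exists m i j,
  [/\ all (leq^~ m) (flatten T), size (nth [::] T j) = i.+1,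
      nth 0 (nth [::] T j) i = m,
      (forall j', j < j' -> m \notin nth [::] T j')
    & size (nth [::] T j.+1) <= i].
Proof.
move=> tT T0; set m := \max_(x <- flatten T) x.
have le : all (leq^~ m) (flatten T).
  by apply/allP => x xT; apply: leq_bigmax_seq.
have mT : m \in flatten T.
  rewrite /m; have : flatten T != [::].
    by case: (T) tT T0 => //= c T' [_ + _ _] _; case: c.
  elim: (flatten T) => //= x s IH _; rewrite big_cons.
  have [->|s0] := eqVneq s [::]; first by rewrite big_nil maxn0 inE.
  by rewrite inE /maxn; case: ifP => _; rewrite ?eqxx // IH ?orbT.
have [c cT mc] := flattenP mT; have jc : index c T < size T by rewrite index_mem.
have ex : exists j, m \in nth [::] T j by exists (index c T); rewrite nth_index.
have bd j : m \in nth [::] T j -> j <= size T by move/nth_col_lt/ltnW.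
case: (ex_maxnP ex bd) => j mj maxj; have jT := nth_col_lt mj.
have /tab_nth tT' := tT; have [sc c0 [sz cc]] := tT' _ jT.
have [i im ei] : exists2 i, i < size (nth [::] T j) & nth 0 (nth [::] T j) i = m.
  by exists (index m (nth [::] T j)); rewrite ?index_mem ?nth_index.
have last j' : j < j' -> m \notin nth [::] T j'.
  by move=> jj'; apply/negP => /maxj; rewrite leqNgt jj'.
exists m, i, j; split=> //.
  apply/eqP; rewrite eqn_leq im andbT leqNgt; apply/negP => lt.
  have : nth 0 (nth [::] T j) i < nth 0 (nth [::] T j) i.+1 := sortedP 0 sc i lt.
  rewrite ei ltnNge => /negP; apply.
  by apply: (allP le); apply: (@mem_flatten_col _ j); apply: mem_nth.
rewrite leqNgt; apply/negP => lt; have /negP := last _ (ltnSn j); apply.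
suff <- : nth 0 (nth [::] T j.+1) i = m by apply: mem_nth.
apply/eqP; rewrite eqn_leq -{2}ei cc // andbT.
by apply: (allP le); apply: (@mem_flatten_col _ j.+1); apply: mem_nth.
Qed.

Lemma nth_set_entry T j z j' :
  nth [::] (set_entry T ((size (nth [::] T j)).+1, j.+1) z) j' =
  if j' == j then rcons (nth [::] T j) z else nth [::] T j'.
Proof. by rewrite set_entry_addable nth_set_nth. Qed.

Lemma entry_set_entry T j z (b := ((size (nth [::] T j)).+1, j.+1)) :
  entry (set_entry T b z) b = z.
Proof. by rewrite /b /entry set_entry_addable /= nth_set_nth /= eqxx nth_rcons ltnn eqxx. Qed.

Lemma eq_shape_nth (T1 T2 : columns) j : map size T1 = map size T2 ->
  size (nth [::] T1 j) = size (nth [::] T2 j).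
Proof. by move=> e; have := congr1 (fun s => nth 0 s j) e; rewrite /= !nth_map_size. Qed.

Lemma bumping_rcons_addable w p : exists j,
  [/\ j <= size (bumping w).1,
      new_box p.2 (bumping w).2 = ((size (nth [::] (bumping w).1 j)).+1, j.+1)
    & bumping (rcons w p) =
      (set_entry (bumping w).1 ((size (nth [::] (bumping w).1 j)).+1, j.+1) p.1,
       col_bump p.2 (bumping w).2)].
Proof.
have [j jT e] := new_box_addable p.2 (bumping w).2; exists j.
rewrite (eq_shape_nth _ (bumping_shape w)) bumping_rcons /bumping_step e; split=> //.
by rewrite -(size_map size) bumping_shape size_map.
Qed.

Lemma labels_le w p : sorted lex_rel (rcons w p) -> all (leq^~ p.1) (flatten (bumping w).1).
Proof.
move=> /lex_rel_labels; rewrite /unzip1 map_rcons (sorted_pairwise leq_trans).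
by rewrite pairwise_rcons => /andP[+ _]; rewrite (perm_all _ (perm_bumping w).1).
Qed.

Lemma sorted_lex_rcons w p : sorted lex_rel (rcons w p) -> sorted lex_rel w.
Proof. by rewrite -cats1 => /cat_sorted2[]. Qed.

(** Equal labels come with weakly decreasing letters, whose new boxes move strictly to the right. As
    [new_box] counts columns from 1 and [nth] from 0, the columns j in question are those strictly
    to the right of the new box. *)
Lemma last_label_rightmost w p j : sorted lex_rel (rcons w p) ->
  (new_box p.2 (bumping w).2).2 <= j -> p.1 \notin nth [::] (bumping (rcons w p)).1 j.
Proof.
elim/last_ind: w p j => [|w q IH] p j sw.
  by case: j => // j _; rewrite /bumping /= /set_entry /= nth_nil.
have [k [kT eb ->]] := bumping_rcons_addable (rcons w q) p.
rewrite eb /= => kj; rewrite nth_set_entry gtn_eqF //.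
have qp : lex_rel q p.
  have := sw; rewrite (sorted_pairwise lex_rel_trans) pairwise_rcons all_rcons.
  by case/andP => /andP[].
have sw' := sorted_lex_rcons sw.
have [qp1|pq1] := ltnP q.1 p.1.
  apply/negP => /mem_flatten_col; apply/negP.
  rewrite (perm_mem (perm_bumping _).1); apply/negP => pw.
  have := lex_rel_labels sw'; rewrite /unzip1 map_rcons (sorted_pairwise leq_trans).
  rewrite pairwise_rcons => /andP[+ _].
  move: pw; rewrite /unzip1 map_rcons mem_rcons inE gtn_eqF //= => pw /allP/(_ _ pw).
  by rewrite /= leqNgt qp1.
have [e le] : q.1 = p.1 /\ p.2 <= q.2 by move: qp; rewrite /lex_rel; lia.
rewrite -e; apply: IH => //; apply: leq_trans kj; have [_ tT] := tab_bumping (sorted_lex_rcons sw').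
have := new_box_right tT le; have -> : col_bump q.2 (bumping w).2 = (bumping (rcons w q)).2.
  by rewrite bumping_rcons.
by rewrite eb /= => /ltnW.
Qed.

Lemma rev_bumpingS k T1 T2 (b := max_box T1) : rev_bumping k.+1 T1 T2 =
  rcons (rev_bumping k (del_box T1 b) (rev_bump T2 b).1) (entry T1 b, (rev_bump T2 b).2).
Proof. by []. Qed.

(** The box added last carries the right-most maximal label, so it is the one that [max_box]
    selects, and [col_bumpK] undoes the last insertion. *)
Lemma bumpingK w : sorted lex_rel w ->
  rev_bumping (size w) (bumping w).1 (bumping w).2 = w.
Proof.
elim/last_ind: w => // w p IH sw; have sw' := sorted_lex_rcons sw.
have [tT1 _] := tab_bumping sw; have [tT1' tT2'] := tab_bumping sw'.
have right j := @last_label_rightmost w p j sw.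
have [j [jT eb e]] := bumping_rcons_addable w p; rewrite size_rcons rev_bumpingS.
have em : max_box (bumping (rcons w p)).1 = ((size (nth [::] (bumping w).1 j)).+1, j.+1).
  apply: (@max_boxE _ p.1) => //.
  - rewrite (perm_all _ (perm_bumping _).1) /unzip1 map_rcons all_rcons leqnn /=.
    by rewrite -(perm_all _ (perm_bumping w).1) labels_le.
  - by rewrite e nth_set_entry eqxx size_rcons.
  - by rewrite e nth_set_entry eqxx nth_rcons ltnn eqxx.
  by move=> j' jj'; apply: right; rewrite eb.
have -> : (bumping (rcons w p)).2 = col_bump p.2 (bumping w).2 by rewrite e.
rewrite em -eb col_bumpK // eb e entry_set_entry.
by rewrite set_entry_addable del_box_set_nth ?tab_columns_neq0 // IH // -surjective_pairing.
Qed.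

(** The second conclusion serves the induction: a column that fitted on the left of T still fits
    after the deletion. *)
Lemma del_box_corner T i j (T' := del_box T (i.+1, j.+1)) :
  tab T -> size (nth [::] T j) = i.+1 -> size (nth [::] T j.+1) <= i ->
  [/\ tab T', forall c, col_le c (head [::] T) -> col_le c (head [::] T'),
      set_entry T' (i.+1, j.+1) (entry T (i.+1, j.+1)) = T
    & size (nth [::] T' j) = i /\ j <= size T'].
Proof.
rewrite {}/T'; elim: T j => [|c T IH] j; first by rewrite nth_nil.
case=> sc c0 cc tT; case: j => [|j] /= ej ej1; last first.
  have [tT' h e [si jT']] := IH j tT ej ej1.
  have -> : del_box (c :: T) (i.+1, j.+2) = c :: del_box T (i.+1, j.+1).
    by rewrite /del_box /= c0.
  split=> //=; first by split=> //; apply: h.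
  by move: e; rewrite /set_entry /entry /= => ->.
have -> : del_box (c :: T) (i.+1, 1) = if take i c == [::] then T else take i c :: T.
  rewrite /del_box /= ; have /all_filterP -> := tab_columns_neq0 tT.
  by case: eqP.
have ic : i < size c by rewrite ej.
have szt : size (take i c) = i by rewrite size_takel // ltnW.
have erc : rcons (take i c) (nth 0 c i) = c by rewrite -take_nth // -ej take_size.
case: eqP => [/(congr1 size)/= e0|t0] /=.
  have i0 : i = 0 by rewrite -szt.
  have T0 : T = [::].
    by case: (T) tT ej1 => //= d T' [_ + _ _]; rewrite -size_eq0 i0; case: size.
  subst i T; do !split=> //; rewrite /set_entry /entry /=.
  by case: (c) ej => [|z []].
split=> //=.
- split=> //; [exact: take_sorted | exact/eqP | split; first by rewrite -nth0 szt].
  by move=> r rT; rewrite nth_take ?cc.2 // (leq_trans rT) // -nth0.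
- move=> d [sd ld]; split=> [|r]; rewrite szt; first by rewrite (leq_trans _ sd) // ej.
  by move=> ri; rewrite nth_take // ld // ej ltnW.
- by rewrite /set_entry /entry /= -[X in set_nth _ _ X]szt set_nth_size erc.
Qed.

(** The new shape depends on the old shape and the box only; thus two tableaux of one shape keep a
    common shape when the same box is deleted. *)
Lemma shape_del_box T b : map size (del_box T b) =
  [seq s <- set_nth 0 (map size T) b.2.-1 (minn b.1.-1 (nth 0 (map size T) b.2.-1)) | s != 0].
Proof.
rewrite /del_box nth_map_size -size_take_min; move: (take _ _) => c.
have -> : set_nth 0 (map size T) b.2.-1 (size c) = map size (set_nth [::] T b.2.-1 c).
  elim: T (b.2.-1) => [|d T IH] [|k] //=; last by rewrite IH.
  by elim: k => //= k ->.
by rewrite filter_map; congr map; apply: eq_filter => d /=; rewrite size_eq0.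
Qed.

Lemma shape_col_bump x z T :
  map size (col_bump x T) = map size (set_entry T (new_box x T) z).
Proof.
elim: T x => [|c T IH] x //=; case: ifP => kc /=; last first.
  by rewrite (find_noleq kc) !set_nth_size !size_rcons.
rewrite size_set_nth_lt // (IH (nth 0 c (find (leq x) c))).
have [] := new_box_pos (nth 0 c (find (leq x) c)) T.
by case: (new_box _ T) => i [|j].
Qed.

Lemma rev_bumpingP N T1 T2 (w := rev_bumping N T1 T2) :
  tab T1 -> tab T2 -> map size T1 = map size T2 -> size (flatten T1) = N ->
  bumping w = (T1, T2) /\ sorted lex_rel w.
Proof.
rewrite {}/w; elim: N T1 T2 => [|N IH] T1 T2 tT1 tT2 es sz.
  have T10 : T1 = [::].
    by case: (T1) tT1 sz => //= -[|x c] T [].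
  by move: es; rewrite T10; case: T2 tT2.
have T10 : T1 != [::] by apply: contra_eq_neq sz => ->.
have [m [i [j [le si em last sj]]]] := max_box_exists tT1 T10.
have eb : max_box T1 = (i.+1, j.+1) by apply: max_boxE em last.
have ent : entry T1 (i.+1, j.+1) = m by [].
have si2 : size (nth [::] T2 j) = i.+1 by rewrite -(eq_shape_nth _ es).
have sj2 : size (nth [::] T2 j.+1) <= i by rewrite -(eq_shape_nth _ es).
have [tT1' _ eT1 [si' jT1']] := del_box_corner tT1 si sj.
have [tT2' eT2 eb2 _ _] := rev_bumpK tT2 si2 sj2.
rewrite rev_bumpingS eb ent.
set T1' := del_box _ _ in tT1' eT1 si' jT1' *.
set r := rev_bump _ _ in tT2' eT2 eb2 *.
(* [r.1] results from putting a dummy label 0 into its new box and deleting it again; the shape in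
   between is that of T2, hence of T1. *)
have es' : map size T1' = map size r.1.
  have [k kr ebr] := new_box_addable r.2 r.1; move: ebr; rewrite eb2 => ebr.
  rewrite -[in RHS](@del_box_set_nth r.1 k 0 (tab_columns_neq0 tT2') kr).
  rewrite -set_entry_addable -ebr !shape_del_box es -{1 2}eT2.
  by rewrite (shape_col_bump r.2 0 r.1) eb2.
have pm : perm_eq (flatten T1) (m :: flatten T1').
  rewrite -eT1 ent -{1}si' set_entry_addable; exact: perm_flatten_set_entry.
have sz' : size (flatten T1') = N.
  by apply/eqP; rewrite -eqSS -sz (perm_size pm).
have [ew sw] := IH T1' r.1 tT1' tT2' es' sz'.
split; first by rewrite bumping_rcons /bumping_step ew [fst _]/= [snd _]/= eb2 eT2 -ent eT1.
move: ew sw; case/lastP: (rev_bumping N T1' r.1) => // w q ew sw.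
rewrite (sorted_pairwise lex_rel_trans) pairwise_rcons -(sorted_pairwise lex_rel_trans) sw andbT.
suff qp : lex_rel q (m, r.2).
  rewrite all_rcons qp /=; move: sw.
  rewrite (sorted_pairwise lex_rel_trans) pairwise_rcons => /andP[/allP wq _].
  by apply/allP => z /wq zq; apply: lex_rel_trans zq qp.
have [k [kT nb e]] := bumping_rcons_addable w q; rewrite ew in e.
have [e1 e2] : T1' = set_entry (bumping w).1 ((size (nth [::] (bumping w).1 k)).+1, k.+1) q.1 /\
  r.1 = col_bump q.2 (bumping w).2 by case: e.
have qk : q.1 \in nth [::] T1' k by rewrite e1 nth_set_entry eqxx mem_rcons inE eqxx.
have qm : q.1 <= m.
  by apply: (allP le); rewrite (perm_mem pm) inE (mem_flatten_col qk) orbT.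
rewrite /lex_rel /=; case: ltngtP qm => //= eqm _.
(* If the letter of q were smaller than that of the last pair, the new box of q would lie weakly to
   the right of the removed box, with the same maximal label. In the same column this contradicts
   strictness, further right it contradicts the choice of the removed box. *)
rewrite leqNgt; apply/negP => lt.
have [_ tT] := tab_bumping (sorted_lex_rcons sw).
have := new_box_left tT lt; rewrite -e2 eb2 nb /= ltnS leq_eqVlt => /predU1P[ejk|jk].
  have : sorted ltn (nth [::] T1 j).
    by have /tab_nth/(_ j)[] := tT1 => //; apply: (@nth_col_lt _ _ m); rewrite -em mem_nth // si.
  have -> : nth [::] T1 j = rcons (nth [::] T1' j) m.
    by rewrite -{1}eT1 ent -{1}si' nth_set_entry eqxx.
  rewrite sorted_ltn_rcons => /andP[_ /allP/(_ q.1)].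
  by rewrite ejk qk eqm ltnn => /(_ isT).
have /negP := last _ jk; apply; rewrite -eqm -eT1 ent -{1}si' nth_set_entry.
by rewrite gtn_eqF.
Qed.

(** * Semistandard fillings of skew shapes *)

Lemma rowlen_mono l i i' : young l -> 0 < i -> i <= i' -> rowlen l i' <= rowlen l i.
Proof. by move=> yl; case: i => // i _; case: i' => // i' ii'; apply: young_nth. Qed.

Lemma skew_convex lam nu i j i' j' : young lam -> young nu ->
  (i, j) \in skew lam nu -> (i', j') \in skew lam nu -> i <= i' -> j <= j' ->
  (i, j') \in skew lam nu.
Proof.
move=> yl yn; rewrite !mem_skew => /and3P[i0 lj jn] /and3P[i'0 lj' jn'] ii' jj'.
by rewrite i0 (leq_trans lj) // (leq_trans jn') // rowlen_mono.
Qed.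

Lemma filter_row_skew lam nu k : 0 < k ->
  [seq y <- skew lam nu | y.1 == k] =
  [seq (k, j) | j <- rev (iota (rowlen lam k).+1 (rowlen nu k - rowlen lam k))].
Proof.
move=> k0; rewrite /skew.
set r := fun i => rev (iota (rowlen lam i).+1 (rowlen nu i - rowlen lam i)).
have filt s : uniq s -> [seq y <- [seq (i, j) | i <- s, j <- r i] | y.1 == k] =
    if k \in s then [seq (k, j) | j <- r k] else [::].
  elim: s => //= i s IH /andP[si us]; rewrite filter_cat IH // filter_map inE.
  case: (eqVneq k i) => [e|ki].
    subst i; rewrite (negbTE si) cats0; congr map.
    by apply/all_filterP/allP => j _ /=; rewrite eqxx.
  rewrite (@eq_filter _ _ pred0) ?filter_pred0 // => j /=.
  by rewrite eq_sym (negbTE ki).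
rewrite filt ?iota_uniq // mem_iota add1n ltnS k0 /=.
case: leqP => // lt; suff -> : rowlen nu k = 0 by rewrite sub0n.
by rewrite /rowlen nth_default //; case: (k) k0 lt.
Qed.

Lemma rows_skew lam nu k (P : pred nat) : 0 < k ->
  count (fun y => (y.1 == k) && P y.2) (skew lam nu) =
  count P (iota (rowlen lam k).+1 (rowlen nu k - rowlen lam k)).
Proof.
move=> k0; have := congr1 (count (fun y => P y.2)) (filter_row_skew lam nu k0).
rewrite count_filter count_map count_rev => <-.
by apply: eq_count => y /=; rewrite andbC.
Qed.

Lemma le_J_trans : transitive le_J.
Proof. by move=> [a b] [c d] [e f]; rewrite /le_J /=; lia. Qed.

Lemma le_J_anti x y : le_J x y -> le_J y x -> x = y.
Proof.
case: x y => [a b] [c d]; rewrite /le_J /= => h1 h2.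
by have [-> ->] : a = c /\ b = d by lia.
Qed.

Lemma skew_sorted lam nu : sorted le_J (skew lam nu).
Proof.
rewrite (sorted_pairwise le_J_trans) /skew.
have : pairwise ltn (iota 1 (size nu)) by rewrite -(sorted_pairwise ltn_trans) iota_ltn_sorted.
elim: (iota 1 _) => //= i s IH /andP[/allP si ps]; rewrite pairwise_cat IH // andbT.
apply/andP; split.
  apply/allrelP => x y /mapP[j _ ->] /allpairsPdep[i' [j' [i's _ ->]]].
  by rewrite /le_J /=; have /= -> := si _ i's.
rewrite pairwise_map -(sorted_pairwise (leT := relpre _ _)) => [|a b c]; last exact: le_J_trans.
rewrite rev_sorted; apply: (sub_sorted _ (iota_sorted _ _)) => a b ab.
by rewrite /le_J /= ltnn eqxx.
Qed.

(** The middle-eastern order is the order J; this is how prefixes of the reading meet the conditions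
    on pictures. *)
Lemma index_skew lam nu x y : x \in skew lam nu -> y \in skew lam nu ->
  (index x (skew lam nu) <= index y (skew lam nu)) = le_J x y.
Proof.
move=> xs ys; have refl : reflexive le_J by case=> a b; rewrite /le_J eqxx leqnn orbT.
have H a b : a \in skew lam nu -> b \in skew lam nu ->
    index a (skew lam nu) <= index b (skew lam nu) -> le_J a b.
  move=> ask bsk le; rewrite -(nth_index (0, 0) ask) -(nth_index (0, 0) bsk).
  by apply: (sorted_leq_nth le_J_trans refl (0, 0) (skew_sorted _ _)); rewrite ?inE ?index_mem.
apply/idP/idP; first exact: H.
move=> xy; rewrite leqNgt; apply/negP => lt; have yx := H _ _ ys xs (ltnW lt).
by move: lt; rewrite (le_J_anti xy yx) ltnn.
Qed.

Lemma perm_val_enum (s : seq box) : uniq s -> perm_eq (map val (enum {: seq_sub s})) s.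
Proof.
move=> us; apply: uniq_perm => //; first by rewrite map_inj_uniq ?enum_uniq //; apply: val_inj.
move=> b; apply/mapP/idP => [[x _ ->]|bs]; first exact: valP.
by exists (SeqSub bs); rewrite ?mem_enum.
Qed.

Lemma card_seq_sub_count (s : seq box) (P : pred box) : uniq s ->
  #|[pred x : seq_sub s | P (val x)]| = count P s.
Proof.
move=> us; rewrite -(permP (perm_val_enum us)) count_map.
rewrite [LHS]cardE [in LHS]/enum_mem -enumT size_filter; by apply: eq_count.
Qed.

Section SkewFilling.

Variables (n : nat) (lam nu : seq nat).
Hypotheses (ylam : young lam) (ynu : young nu).
Variable F : box -> nat.
Hypothesis ssF : semistandard n (skew lam nu) F.

Lemma semistandard_le_P : {in skew lam nu &, forall x y, le_P x y -> F x <= F y}.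
Proof.
move=> [i j] [i' j'] xs ys /andP[/= ii' jj']; case: ssF => _ row col.
(* The comparison goes along row i and then down column j', through the box (i, j'). *)
have zs := skew_convex ylam ynu xs ys ii' jj'.
apply: (leq_trans (row _ _ xs zs erefl jj')).
by case: (ltngtP i i') ii' => // [lt|<-] _ //; apply/ltnW/col.
Qed.

(* Boxes with equal entries form a horizontal strip, so that the middle-       *)
(* eastern order lists them from right to left.                                *)
Lemma semistandard_strip : {in skew lam nu &, forall x y, F x = F y ->
  le_J x y = (y.2 <= x.2)}.
Proof.
have strip x y : x \in skew lam nu -> y \in skew lam nu -> F x = F y -> x.1 < y.1 -> y.2 < x.2.
  case: x y => [i j] [i' j'] xs ys /= e lt; rewrite ltnNge; apply/negP => jj'.
  case: ssF => _ row col; have zs := skew_convex ylam ynu xs ys (ltnW lt) jj'.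
  have := leq_ltn_trans (row _ _ xs zs erefl jj') (col _ _ zs ys erefl lt).
  by rewrite e ltnn.
move=> x y xs ys e; rewrite /le_J; case: ltngtP => //= lt.
  by apply/esym; apply: ltnW; apply: strip.
by apply/esym/negbTE; rewrite -ltnNge; apply: strip.
Qed.

Lemma semistandard_row_col : {in skew lam nu &, forall x y, F x = F y -> x.2 = y.2 -> x = y}.
Proof.
move=> x y xs ys e e2; apply: le_J_anti; rewrite semistandard_strip ?e2 //.
Qed.

End SkewFilling.

(** * Pictures *)

Lemma take_index (T : eqType) (s : seq T) k : uniq s ->
  take k s = [seq b <- s | index b s < k].
Proof.
case: k => [|k]; first by rewrite take0 (@eq_filter _ _ pred0) ?filter_pred0.
elim: s k => //= a s IH k /andP[sa us]; rewrite eqxx /=; case: k => [|k].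
  rewrite take0 (@eq_in_filter _ _ pred0) ?filter_pred0 // => b bs.
  by case: eqP => [e|//]; move: sa; rewrite e bs.
rewrite IH //; congr (_ :: _); apply: eq_in_filter => b bs.
by case: eqP => [e|//]; move: sa; rewrite e bs.
Qed.

Lemma count_rows_skew lam nu k : 0 < k ->
  count_mem k (map fst (skew lam nu)) = rowlen nu k - rowlen lam k.
Proof.
move=> k0; have := rows_skew lam nu predT k0; rewrite count_predT size_iota => <-.
by rewrite count_map; apply: eq_count => y /=; rewrite andbT.
Qed.

Lemma fill_at_val lam nu (S : {ffun seq_sub (skew lam nu) -> nat}) x :
  fill_at S (val x) = S x.
Proof. by rewrite /fill_at valK. Qed.

Lemma rowlen_sub lam nu i : {subset diagram lam <= diagram nu} -> 0 < i ->
  rowlen lam i <= rowlen nu i.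
Proof.
move=> sub i0; case e: (rowlen lam i) => [//|j].
have : (i, j.+1) \in diagram nu by apply: sub; rewrite mem_skew i0 e leqnn /rowlen nth_nil.
by rewrite mem_skew => /and3P[].
Qed.

Section Pictures.

Variables (n : nat) (lam1 nu1 lam2 nu2 : seq nat).
Hypotheses (young_lam1 : young lam1) (young_nu1 : young nu1).
Hypotheses (young_lam2 : young lam2) (young_nu2 : young nu2).
Hypothesis (rows_nu2 : size nu2 <= n).
Hypothesis (sub2 : {subset diagram lam2 <= diagram nu2}).

Notation kappa1 := (skew lam1 nu1).
Notation kappa2 := (skew lam2 nu2).

(** Equal entries are read from right to left. Hence [C1] sends x to the very box that the letter of
    x adds when the reading of S is added to [lam2]. *)
Lemma positionE (S : {ffun seq_sub kappa1 -> nat}) x :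
  semistandard n kappa1 (fill_at S) ->
  position S x =
  count_mem (S x) (map (fill_at S) (take (index (val x) kappa1).+1 kappa1)).
Proof.
move=> ss; rewrite take_index ?skew_uniq // count_map count_filter.
pose P b := (fill_at S b == S x) && ((val x).2 <= b.2).
rewrite /position (@eq_card _ _ [pred c | P (val c)]); last first.
  by move=> c; rewrite !inE /P fill_at_val.
rewrite card_seq_sub_count ?skew_uniq //; apply: eq_in_count => b bs.
rewrite /P /= ltnS index_skew //; last exact: valP.
case: eqP => //= e; rewrite (semistandard_strip young_lam1 young_nu1 ss) //; first exact: valP.
by rewrite fill_at_val.
Qed.

Section OnePicture.

Variables (f : {ffun seq_sub kappa1 -> box}).
Variables (g : seq_sub kappa1 -> seq_sub kappa2) (h : seq_sub kappa2 -> seq_sub kappa1).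
Hypotheses (fg : forall x, f x = val (g x)) (gK : cancel g h) (hK : cancel h g).
Hypotheses (Jg : PJ_standard g) (Jh : PJ_standard h).

Let G (b : box) : box := oapp f (0, 0) (insub b).

Let GE x : G (val x) = val (g x).
Proof. by rewrite /G valK /= fg. Qed.

Let GE_mem b (bk : b \in kappa1) : G b = val (g (SeqSub bk)).
Proof. exact: (GE (SeqSub bk)). Qed.

Let F := fill_at (S1 lam1 nu1 f).

Let FE b : b \in kappa1 -> F b = (G b).1.
Proof.
by move=> bk; have := GE (SeqSub bk); have := fill_at_val (S1 lam1 nu1 f) (SeqSub bk);
  rewrite /= /F ffunE fg => -> ->.
Qed.

Lemma picture_perm : perm_eq (map G kappa1) kappa2.
Proof.
apply: uniq_perm; rewrite ?skew_uniq //.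
  rewrite map_inj_in_uniq ?skew_uniq // => b c bk ck.
  by rewrite (GE_mem bk) (GE_mem ck) => /val_inj /(can_inj gK) [].
move=> y; apply/mapP/idP => [[b bk ->]|yk].
  by rewrite (GE_mem bk); apply: valP.
by exists (val (h (SeqSub yk))); [apply: valP | rewrite GE hK].
Qed.

Lemma ME_picture : ME lam1 nu1 F = map fst (map G kappa1).
Proof. by rewrite /ME -map_comp; apply/eq_in_map => b bk; rewrite /= FE. Qed.

Lemma picture_le_J x y : le_P (val (g x)) (val (g y)) -> le_J (val x) (val y).
Proof. by move/Jh; rewrite !gK. Qed.

Lemma picture_count i : 0 < i ->
  count_mem i (ME lam1 nu1 F) = rowlen nu2 i - rowlen lam2 i.
Proof.
by move=> i0; rewrite ME_picture -(count_rows_skew _ _ i0); apply/permP/perm_map/picture_perm.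
Qed.

Lemma picture_semistandard : semistandard n kappa1 F.
Proof.
split.
- move=> b bk; rewrite FE // GE_mem; move: (valP (g (SeqSub bk))).
  case: (val (g (SeqSub bk))) => i j; rewrite mem_skew => /and3P[i0 lj jn]; rewrite /= i0 /=.
  apply: leq_trans (_ : size nu2 <= _); last exact: leqW.
  rewrite leqNgt; apply/negP => lt; move: (leq_trans lj jn).
  by rewrite /rowlen [nth 0 nu2 _]nth_default //; case: (i) lt.
- move=> b c bk ck e1 e2; rewrite !FE //.
  rewrite (GE_mem bk) (GE_mem ck).
  have := Jg (x := SeqSub bk) (x' := SeqSub ck); rewrite /le_P /= e1 leqnn e2 => /(_ isT).
  by rewrite /le_J; lia.
move=> b c bk ck e2 e1; rewrite !FE //.
rewrite (GE_mem bk) (GE_mem ck).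
have := Jg (x := SeqSub bk) (x' := SeqSub ck); rewrite /le_P /= e2 leqnn (ltnW e1) => /(_ isT).
(* If b and c had equal entries, the image of c would be weakly left of that of b in the same row,
   and the inverse map would place c before b in the order J, although b is in a higher row. *)
have := @picture_le_J (SeqSub ck) (SeqSub bk); rewrite /le_P /le_J /= e2; lia.
Qed.

(** Because the inverse map is PJ-standard, the images of the boxes in a prefix of the reading are
    closed downwards under [le_P] in kappa2. Together with [lam2] they therefore fill a Young
    diagram. *)
Lemma picture_lattice i : 0 < i ->
  lattice i (rowlen lam2 i - rowlen lam2 i.+1) (ME lam1 nu1 F).
Proof.
move=> i0; apply/latticeP => k; rewrite ME_picture -!map_take.
set t := take k kappa1.
have tk b : b \in t -> b \in kappa1 by apply: mem_take.
have tG b y : b \in t -> y \in kappa2 -> le_P y (G b) -> y \in map G t.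
  move=> bt yk; have bk := tk _ bt; rewrite (GE_mem bk).
  rewrite -{1}[y]/(val (SeqSub yk)) => /Jh; rewrite gK.
  set c := h _ => cb; apply/mapP; exists (val c); last by rewrite GE hK.
  rewrite /t in_take; last exact: valP.
  apply: (@leq_ltn_trans (index b kappa1)); last by rewrite -in_take.
  by rewrite index_skew //; apply: valP.
have tk2 b : b \in t -> G b \in kappa2.
  by move=> /tk bk; rewrite (GE_mem bk); apply: valP.
pose cols j := [seq y.2 | y <- map G t & y.1 == j].
have sz j : size (cols j) = count_mem j (map fst (map G t)).
  by rewrite size_map size_filter [RHS]count_map.
(* A column occupied in row i + 1 either is at most [rowlen lam2 i], where the box above belongs to
   [lam2], or is also occupied in row i. *)
rewrite -!sz -[X in _ <= X + _](size_iota (rowlen lam2 i.+1).+1) -size_cat.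
apply: uniq_leq_size.
  rewrite map_inj_in_uniq; last first.
    move=> [a b] [c d]; rewrite !mem_filter /= => /andP[/eqP -> _] /andP[/eqP -> _].
    by move=> ->.
  apply: filter_uniq; rewrite map_take; apply: take_uniq.
  by rewrite (perm_uniq picture_perm) skew_uniq.
move=> j /mapP[[i' j'] + /= ->]; rewrite mem_filter => /andP[/= /eqP -> ].
case/mapP => b bt e; have := tk2 _ bt; rewrite -e mem_skew => /andP[_ /andP[lj jn]].
rewrite mem_cat mem_iota; case: (leqP j' (rowlen lam2 i)) => jl; first by apply/orP; left; lia.
apply/orP; right; apply/mapP; exists (i, j') => //; rewrite mem_filter /= eqxx.
apply: (tG b) => //; last by rewrite -e /le_P /= leqnSn leqnn.
by rewrite mem_skew i0 jl (leq_trans jn) // rowlen_mono.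
Qed.

Lemma picture_ME_neq0 : 0 \notin ME lam1 nu1 F.
Proof.
apply/negP => /mapP[b bk e]; have [r _ _] := picture_semistandard.
by have := r _ bk; rewrite -e.
Qed.

Lemma picture_LR : LR_skew_tableaux n lam1 nu1 lam2 nu2 (S1 lam1 nu1 f).
Proof.
split; [exact: picture_semistandard | exact: picture_count |].
apply/adds_toP => //; first exact: picture_ME_neq0.
split=> i i0; first exact: picture_lattice.
by rewrite picture_count // subnKC // rowlen_sub.
Qed.

(** The boxes with the entry of x and weakly to its right correspond under f to the boxes of row k
    of kappa2 up to column m, and there are [m - rowlen lam2 k] of these. *)
Lemma picture_position x : f x = C1 lam1 nu1 lam2 (S1 lam1 nu1 f) x.
Proof.
rewrite !ffunE; have := valP (g x); have e : f x = val (g x) := fg x.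
rewrite -e; case efx: (f x) => [k m] /=; rewrite mem_skew => /andP[k0 /andP[lm mn]].
congr (_, _); pose P y := (y.1 == k) && (y.2 <= m).
have -> : position (S1 lam1 nu1 f) x = count P kappa2.
  rewrite -(permP picture_perm) count_map /position.
  rewrite -card_seq_sub_count ?skew_uniq //; apply: eq_card => c; rewrite !inE /P /=.
  rewrite !ffunE efx -[\val c]/(val c) GE -fg; case: eqP => //= ec.
  have strip := semistandard_strip young_lam1 young_nu1 picture_semistandard (valP c) (valP x).
  rewrite /F !fill_at_val !ffunE efx in strip; rewrite -strip //.
  apply/idP/idP => [cx|le]; last first.
    by apply: picture_le_J; rewrite -!fg efx /le_P /= ec leqnn le.
  rewrite leqNgt; apply/negP => lt.
  have xc : le_J (val x) (val c).
    by apply: picture_le_J; rewrite -!fg efx /le_P /= ec leqnn ltnW.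
  by move: lt; rewrite (val_inj (le_J_anti cx xc)) efx ltnn.
rewrite /P (rows_skew _ _ (leq^~ m) k0).
have -> : rowlen nu2 k - rowlen lam2 k = (m - rowlen lam2 k) + (rowlen nu2 k - m) by lia.
rewrite iotaD count_cat.
have -> : count (leq^~ m) (iota (rowlen lam2 k).+1 (m - rowlen lam2 k)) = m - rowlen lam2 k.
  rewrite -[RHS](size_iota (rowlen lam2 k).+1); apply/eqP; rewrite -all_count.
  by apply/allP => j; rewrite mem_iota; lia.
rewrite (eq_in_count (a2 := pred0)) ?count_pred0; first by lia.
by move=> j; rewrite mem_iota /=; lia.
Qed.

End OnePicture.

Lemma S1_pictures f : pictures kappa1 kappa2 f ->
  LR_skew_tableaux n lam1 nu1 lam2 nu2 (S1 lam1 nu1 f).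
Proof. by case=> g [h [fg gK hK Jg Jh]]; apply: picture_LR fg gK hK Jg Jh. Qed.

Lemma S1K f : pictures kappa1 kappa2 f -> C1 lam1 nu1 lam2 (S1 lam1 nu1 f) = f.
Proof.
case=> g [h [fg gK hK Jg Jh]]; apply/ffunP => x.
by rewrite -(picture_position fg gK hK Jg Jh).
Qed.

Lemma C1K S : S1 lam1 nu1 (C1 lam1 nu1 lam2 S) = S.
Proof. by apply/ffunP => x; rewrite !ffunE. Qed.

End Pictures.

Lemma semistandard_ME_neq0 n lam nu F : semistandard n (skew lam nu) F -> 0 \notin ME lam nu F.
Proof. by case=> r _ _; apply/negP => /mapP[b bk e]; have := r _ bk; rewrite -e. Qed.

Section SkewTableauPicture.

Variables (n : nat) (lam1 nu1 lam2 nu2 : seq nat).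
Hypotheses (young_lam1 : young lam1) (young_nu1 : young nu1).
Hypotheses (young_lam2 : young lam2) (young_nu2 : young nu2).

Notation kappa1 := (skew lam1 nu1).
Notation kappa2 := (skew lam2 nu2).

Hypothesis (card12 : size kappa1 = size kappa2).

Variable S : {ffun seq_sub kappa1 -> nat}.
Hypothesis LR_S : LR_skew_tableaux n lam1 nu1 lam2 nu2 S.

Let ss : semistandard n kappa1 (fill_at S).
Proof. by case: LR_S. Qed.

Let f := C1 lam1 nu1 lam2 S.

Let S_gt0 x : 0 < S x.
Proof. by case: ss => r _ _; have /andP[] := r _ (valP x); rewrite fill_at_val. Qed.

Let prefix (x : seq_sub kappa1) : seq nat :=
  map (fill_at S) (take (index (val x) kappa1).+1 kappa1).

Let position_eq x : position S x = count_mem (S x) (prefix x).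
Proof. exact: (positionE young_lam1 young_nu1 _ ss). Qed.

Let position_gt0 x : 0 < position S x.
Proof.
by rewrite /position lt0n; apply/negP => /eqP/card0_eq/(_ x); rewrite inE eqxx leqnn.
Qed.

Lemma C1_mem x : f x \in kappa2.
Proof.
have p0 := position_gt0 x; rewrite /f ffunE mem_skew S_gt0 -[X in X <= _]addn1 leq_add2l p0 /=.
have le : position S x <= count_mem (S x) (ME lam1 nu1 (fill_at S)).
  by rewrite position_eq; apply/leq_count_subseq/map_subseq/take_subseq.
by case: LR_S => _ cnt _; rewrite cnt // in le; lia.
Qed.

Lemma C1_lattice x k k' : 0 < k -> k <= k' ->
  rowlen lam2 k' + count_mem k' (prefix x) <= rowlen lam2 k + count_mem k (prefix x).
Proof.
case: LR_S => _ _ /(adds_toP young_lam2 young_nu2 (semistandard_ME_neq0 ss))[lat _] k0.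
move=> /subnKC <-; elim: (k' - k) => [|m IH]; first by rewrite addn0.
apply: leq_trans IH; rewrite addnS; have km : 0 < k + m by rewrite addn_gt0 k0.
have /latticeP/(_ (index (val x) kappa1).+1) := lat _ km.
rewrite /ME -map_take -/(prefix x).
by have := rowlen_mono young_lam2 km (leqnSn _); lia.
Qed.

Lemma C1_inj x y : f x = f y -> x = y.
Proof.
rewrite /f !ffunE => -[e]; rewrite e => /addnI ep.
wlog lt : x y e ep / (val x).2 < (val y).2 => [H|].
  case: (ltngtP (val x).2 (val y).2) => lt; first exact: H.
    by apply/esym/H.
  apply: val_inj; apply: (semistandard_row_col young_lam1 young_nu1 ss) => //; try exact: valP.
  by rewrite !fill_at_val.
suff : position S y < position S x by rewrite ep ltnn.
apply: proper_card; apply/properP; split.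
  apply/fintype.subsetP => c; rewrite !inE e => /andP[-> yc]; exact: leq_trans (ltnW lt) yc.
by exists x; rewrite !inE ?eqxx ?leqnn // e eqxx /= -ltnNge.
Qed.

(** Suppose y is read before x. Right after y, the row of f(y) has length equal to the column of
    f(y), and the row of f(x), being weakly above it, is at least as long. But x has not yet been
    read, so the column of f(x) is larger still. *)
Lemma C1_le_J x y : le_P (f x) (f y) -> le_J (val x) (val y).
Proof.
rewrite /f !ffunE /le_P /= => /andP[kk' pp'].
rewrite -(index_skew (valP x) (valP y)) leqNgt; apply/negP => lt.
have := C1_lattice y (S_gt0 x) kk'; rewrite -(position_eq y).
suff : count_mem (S x) (prefix y) < position S x by lia.
have e : take (index (val x) kappa1).+1 kappa1 =
    rcons (take (index (val x) kappa1) kappa1) (val x).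
  by rewrite (take_nth (val x)) ?nth_index ?index_mem //; apply: valP.
rewrite position_eq /prefix e map_rcons -cats1 count_cat fill_at_val /=.
rewrite eqxx addn1 ltnS -(take_takel _ lt).
by apply/leq_count_subseq/map_subseq/take_subseq.
Qed.

(** The inverse comes from counting: [C1] is injective into kappa2, which has as many boxes as
    kappa1. *)
Lemma C1_pictures : pictures kappa1 kappa2 f.
Proof.
pose g x : seq_sub kappa2 := SeqSub (C1_mem x).
have gi : injective g by move=> x y /(congr1 val) /C1_inj.
have [h gK hK] : bijective g.
  by apply: inj_card_bij => //; rewrite !card_seq_sub ?skew_uniq // -card12 leqnn.
exists g, h; split=> //.
- move=> x y /= xy; have := semistandard_le_P young_lam1 young_nu1 ss (valP x) (valP y) xy.
  rewrite !fill_at_val /le_J !ffunE /= leq_eqVlt => /predU1P[e|-> //].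
  rewrite e eqxx ltnn leq_add2l /= ; apply: subset_leq_card; apply/fintype.subsetP => c.
  rewrite !inE e => /andP[-> yc]; apply: leq_trans yc; by case/andP: xy.
by move=> y y'; rewrite -{1}(hK y) -{1}(hK y') => /C1_le_J.
Qed.

End SkewTableauPicture.

(** * The bijections *)

Lemma set_bij_can (A B : Type) (X : set A) (Y : set B) (f : A -> B) (g : B -> A) :
  set_fun X Y f -> set_fun Y X g -> (forall x, X x -> g (f x) = x) ->
  (forall y, Y y -> f (g y) = y) -> set_bij X Y f.
Proof.
move=> fXY gYX fK gK; split=> // [x x' /set_mem Xx /set_mem Xx' e|y Yy].
  by rewrite -(fK x) // e fK.
by exists (g y); [apply: gYX | apply: gK].
Qed.

(** Here the row reading is replaced by the column reading; mu then enters through the shape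
    alone. *)
Lemma LR_crystalP n mu lam nu T : young mu -> young lam -> young nu ->
  LR_crystal n mu lam nu T <->
  [/\ tab T, row_shape T = mu, all (fun x => 1 <= x <= n.+1) (flatten T),
      forall i, 0 < i -> lattice i (rowlen lam i - rowlen lam i.+1) (flatten (rev T))
    & forall i, 0 < i -> rowlen nu i = rowlen lam i + count_mem i (flatten T)].
Proof.
move=> ymu ylam ynu.
have ME_rows : tab T -> row_shape T = mu ->
    lat_equiv (ME [::] mu (entry T)) (flatten (rev T)).
  move=> tT sT; have e : map size T = conj_shape mu by rewrite -sT conj_shapeK // tab_shape.
  rewrite ME_row_reading //; apply: lat_equiv_row_reading => //.
  by rewrite -nth0 -nth_map_size e nth_conj_shape ?count_size //; case/andP: ymu.
have rv : perm_eq (flatten (rev T)) (flatten T) by apply: perm_flatten; rewrite perm_rev.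
have ME0 : tab T -> row_shape T = mu -> all (fun x => 1 <= x <= n.+1) (flatten T) ->
    0 \notin ME [::] mu (entry T).
  move=> tT sT aT; rewrite (perm_mem (perm_trans (ME_rows tT sT).1 rv)).
  by apply/negP => /(allP aT).
split=> [[/(tableauxP n T ymu) [tT sT aT] /(adds_toP ylam ynu (ME0 tT sT aT))[lat cnt]]|].
  have [p e] := ME_rows tT sT; split=> // i i0; first by rewrite -e lat.
  by rewrite cnt // (permP (perm_trans p rv)).
case=> tT sT aT lat cnt; split; first exact/tableauxP.
have [p e] := ME_rows tT sT; apply/(adds_toP ylam ynu (ME0 tT sT aT)); split=> i i0.
  by rewrite e lat.
by rewrite cnt // (permP (perm_trans p rv)).
Qed.

Section Arrays.

Variables (n N : nat) (lam1 nu1 lam2 nu2 : seq nat).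
Hypotheses (young_lam1 : young lam1) (young_nu1 : young nu1).
Hypotheses (young_lam2 : young lam2) (young_nu2 : young nu2).
Hypothesis rows_nu1 : size nu1 <= n.
Hypothesis sub1 : {subset diagram lam1 <= diagram nu1}.
Hypothesis sub2 : {subset diagram lam2 <= diagram nu2}.
Hypothesis card1 : size (skew lam1 nu1) = N.

Notation kappa1 := (skew lam1 nu1).

(** The conditions on the two tableaux become conditions on the array: [lat_equiv_bumping] transfers
    the one on the letters, [lattice_bumping_labels] the one on the labels. *)
Lemma LR_arraysP w : LR_arrays n N lam1 nu1 lam2 nu2 w <->
  [/\ sorted lex_rel w, unzip1 w = map fst kappa1,
      all (fun x => 1 <= x <= n.+1) (unzip2 w),
      (forall i, 0 < i -> rows_strict (rowlen lam1 i - rowlen lam1 i.+1)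
        (row_word i w) (row_word i.+1 w))
    & (forall i, 0 < i -> lattice i (rowlen lam2 i - rowlen lam2 i.+1) (unzip2 w)) /\
      (forall i, 0 < i -> count_mem i (unzip2 w) = rowlen nu2 i - rowlen lam2 i)].
Proof.
have [p1 p2] := perm_bumping w; have [_ lat2] := lat_equiv_bumping w.
have k0 : all (fun x => 1 <= x <= n.+1) (map fst kappa1).
  apply/allP => i /mapP[[i' j] + ->]; rewrite mem_skew => /and3P[/= -> lj jn] /=.
  apply: leq_trans (_ : size nu1 <= _); last exact: leqW.
  rewrite leqNgt; apply/negP => lt; move: (leq_trans lj jn).
  by rewrite /rowlen [nth 0 nu1 _]nth_default //; case: (i') lt.
split=> [[sz /lexicographicP sw cnt1 cnt2 [mu [ymu T2 T1]]]|].
  have [_ _ a2 l2 c2] := (LR_crystalP n _ ymu young_lam2 young_nu2).1 T2.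
  have [_ _ a1 l1 c1] := (LR_crystalP n _ ymu young_lam1 young_nu1).1 T1.
  split=> //.
  (* Both sequences increase weakly, so equal multiplicities make them equal. *)
  - apply: (sorted_eq leq_trans anti_leq); first exact: lex_rel_labels.
      rewrite sorted_map; apply: sub_sorted (skew_sorted _ _) => b c.
      by case/orP => [/ltnW //|/andP[/eqP /= ->]].
    apply/allP => i; rewrite mem_cat => ii /=; have i0 : 0 < i.
      case/orP: ii => [|/(allP k0)/andP[]//]; rewrite -(perm_mem p1) => /(allP a1)/andP[]//.
    by rewrite cnt1 // count_rows_skew.
  - by rewrite -(perm_all _ p2).
  - by move=> i i0; apply/(lattice_bumping_labels _ _ sw)/l1.
  by split=> // i i0; rewrite lat2 l2.
case=> sw e1 a2 str [l2 c2]; have [tT1 tT2] := tab_bumping sw.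
have ysh : young (row_shape (bumping w).2) by apply/young_conj/tab_shape.
split=> //.
- by rewrite -(size_map fst) -/(unzip1 w) e1 size_map.
- exact/lexicographicP.
- by move=> i i0; rewrite e1 count_rows_skew.
exists (row_shape (bumping w).2); split=> //; apply/LR_crystalP => //; split=> //.
- by rewrite (perm_all _ p2).
- by move=> i i0; rewrite -lat2 l2.
- by move=> i i0; rewrite (permP p2) c2 // subnKC // rowlen_sub.
- by rewrite /row_shape bumping_shape.
- by rewrite (perm_all _ p1) e1.
- by move=> i i0; apply/lattice_bumping_labels/str.
by move=> i i0; rewrite (permP p1) e1 count_rows_skew // subnKC // rowlen_sub.
Qed.

(** [S2] for an arbitrary function on boxes, so that the conditions on the array can be matched with
    those on F one at a time. *)
Definition row_reading_array (F : box -> nat) : array := [seq (b.1, F b) | b <- kappa1].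

Lemma row_word_reading F i : 0 < i ->
  row_word i (row_reading_array F) =
  [seq F (i, j) | j <- rev (iota (rowlen lam1 i).+1 (rowlen nu1 i - rowlen lam1 i))].
Proof.
move=> i0; rewrite /row_word /row_reading_array filter_map -map_comp.
rewrite (@eq_filter _ _ (fun y => y.1 == i)) // filter_row_skew // -map_comp.
by apply: eq_map.
Qed.

Lemma nth_row_word_reading F i k : 0 < i -> k < rowlen nu1 i - rowlen lam1 i ->
  nth 0 (row_word i (row_reading_array F)) k = F (i, rowlen nu1 i - k).
Proof.
move=> i0 ki; rewrite row_word_reading // map_rev nth_rev size_map size_iota //.
rewrite (nth_map 0) ?size_iota; last by lia.
by rewrite nth_iota; [congr (F (_, _)); lia | lia].
Qed.

(** With this d, the offset in [rows_strict] becomes the difference of the lengths of rows i and i +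
    1 of [nu1], so that entries of the same column are compared. *)
Lemma rows_strict_reading F i : 0 < i ->
  rows_strict (rowlen lam1 i - rowlen lam1 i.+1)
    (row_word i (row_reading_array F)) (row_word i.+1 (row_reading_array F)) <->
  forall j, (i, j) \in kappa1 -> (i.+1, j) \in kappa1 -> F (i, j) < F (i.+1, j).
Proof.
move=> i0.
have szr k : 0 < k -> size (row_word k (row_reading_array F)) = rowlen nu1 k - rowlen lam1 k.
  by move=> k0; rewrite row_word_reading // size_map size_rev size_iota.
have ln1 := rowlen_sub sub1 i0; have ln2 := rowlen_sub sub1 (ltn0Sn i).
have l12 := rowlen_mono young_lam1 i0 (leqnSn i).
have n12 := rowlen_mono young_nu1 i0 (leqnSn i).
rewrite /rows_strict /row_below !szr //.
have -> : rowlen lam1 i - rowlen lam1 i.+1 + (rowlen nu1 i - rowlen lam1 i) -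
  (rowlen nu1 i.+1 - rowlen lam1 i.+1) = rowlen nu1 i - rowlen nu1 i.+1 by lia.
split=> [[_ H] j|H].
  rewrite !mem_skew => /and3P[_ l1 n1] /and3P[_ l2 n2].
  have := H (rowlen nu1 i.+1 - j); rewrite !nth_row_word_reading //; try lia.
  have -> : rowlen nu1 i - (rowlen nu1 i.+1 - j + (rowlen nu1 i - rowlen nu1 i.+1)) = j by lia.
  have -> : rowlen nu1 i.+1 - (rowlen nu1 i.+1 - j) = j by lia.
  by apply; lia.
split; first by lia.
move=> k kS kR; rewrite !nth_row_word_reading //.
have -> : rowlen nu1 i - (k + (rowlen nu1 i - rowlen nu1 i.+1)) = rowlen nu1 i.+1 - k by lia.
by apply: H; rewrite mem_skew; lia.
Qed.

Lemma lex_row_reading F : sorted lex_rel (row_reading_array F) <->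
  {in kappa1 &, forall b c, b.1 = c.1 -> b.2 <= c.2 -> F b <= F c}.
Proof.
split=> [sw b c bk ck e1 e2|H].
  have refl : reflexive lex_rel by case=> x y; rewrite /lex_rel eqxx leqnn orbT.
  have : index c kappa1 <= index b kappa1 by rewrite index_skew // /le_J e1 eqxx e2 orbT.
  move/(sorted_leq_nth lex_rel_trans refl (0, 0) sw).
  rewrite !inE size_map !index_mem => /(_ ck bk).
  by rewrite !(nth_map (0, 0)) ?index_mem // !nth_index // /lex_rel /= e1 ltnn eqxx.
apply: (homo_sorted_in _ _ (skew_sorted lam1 nu1)); last exact/allss.
move=> b c bk ck; rewrite /le_J /lex_rel /= => /orP[-> //|/andP[/eqP e1 e2]].
by rewrite e1 eqxx ltnn H.
Qed.

(** Columns of a skew diagram have no gaps, so vertical neighbours suffice. *)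
Lemma column_strict_adjacent F :
  {in kappa1 &, forall b c, b.2 = c.2 -> b.1 < c.1 -> F b < F c} <->
  forall i, 0 < i -> forall j, (i, j) \in kappa1 -> (i.+1, j) \in kappa1 ->
  F (i, j) < F (i.+1, j).
Proof.
split=> [H i _ j ik ik'|H]; first exact: H.
move=> [i j] [i' j'] /= bk + ej; rewrite -{}ej => + lt.
rewrite -(subnKC lt); elim: (i' - i.+1) => [|m IH]; rewrite ?addn0 ?addnS.
  by apply: H => //; move: bk; rewrite mem_skew => /andP[].
move=> ck; have ck' : (i.+1 + m, j) \in kappa1.
  move: bk ck; rewrite !mem_skew => /and3P[i0 l1 n1] /and3P[_ l2 n2].
  have h1 : rowlen lam1 (i.+1 + m) <= rowlen lam1 i by apply: rowlen_mono => //; lia.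
  have h2 : rowlen nu1 (i.+1 + m).+1 <= rowlen nu1 (i.+1 + m) by apply: rowlen_mono.
  by rewrite (leq_ltn_trans h1 l1) (leq_trans n2 h2).
by apply: ltn_trans (IH ck') (H _ _ _ ck' ck); rewrite addSn.
Qed.

(** As an equivalence this serves both directions: together with [C2K] it also shows that [C2] maps
    arrays to skew tableaux. *)
Lemma LR_skew_arrays S : LR_skew_tableaux n lam1 nu1 lam2 nu2 S <->
  LR_arrays n N lam1 nu1 lam2 nu2 (S2 lam1 nu1 S).
Proof.
have e1 : unzip1 (S2 lam1 nu1 S) = map fst kappa1 by rewrite /unzip1 -map_comp.
have e2 : unzip2 (S2 lam1 nu1 S) = ME lam1 nu1 (fill_at S) by rewrite /unzip2 -map_comp.
rewrite LR_arraysP e1 e2.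
split=> [[ss cnt]|[/lex_row_reading row _ rng str [lat cnt]]].
  have [rng row col] := ss.
  move=> /(adds_toP young_lam2 young_nu2 (semistandard_ME_neq0 ss))[lat _].
  split=> //; first exact/lex_row_reading.
    by apply/allP => x /mapP[b bk ->]; apply: rng.
  by move=> i i0; apply/rows_strict_reading => //; apply: (column_strict_adjacent _).1.
have ss : semistandard n kappa1 (fill_at S).
  split=> //; first by move=> b bk; apply: (allP rng); apply: map_f.
  by apply/column_strict_adjacent => i i0; apply/rows_strict_reading/str.
split=> //; apply/(adds_toP young_lam2 young_nu2 (semistandard_ME_neq0 ss)); split=> // i i0.
by rewrite cnt // subnKC // rowlen_sub.
Qed.

Lemma S2K S : C2 lam1 nu1 (S2 lam1 nu1 S) = S.
Proof.
apply/ffunP => x; rewrite ffunE /unzip2 -map_comp (nth_map (0, 0)) ?index_mem; last exact: valP.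
by rewrite nth_index; [exact: fill_at_val | exact: valP].
Qed.

Lemma C2K w : LR_arrays n N lam1 nu1 lam2 nu2 w -> S2 lam1 nu1 (C2 lam1 nu1 w) = w.
Proof.
move=> /LR_arraysP[_ e1 _ _ _]; rewrite -[RHS]zip_unzip e1.
have sz : size (unzip2 w) = size kappa1.
  by rewrite size_map -(size_map fst) -/(unzip1 w) e1 size_map.
rewrite /S2 -[X in _ = zip _ X](_ : map (fill_at (C2 lam1 nu1 w)) kappa1 = _) ?zip_map //.
apply: (@eq_from_nth _ 0); first by rewrite size_map sz.
move=> k; rewrite size_map => kk; rewrite (nth_map (0, 0)) //.
have bk := mem_nth (0, 0) kk; rewrite -[nth _ _ _]/(val (SeqSub bk)) fill_at_val ffunE /=.
by rewrite index_uniq // skew_uniq.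
Qed.

Lemma S3_arrays w : LR_arrays n N lam1 nu1 lam2 nu2 w -> LR_pairs n N lam1 nu1 lam2 nu2 (S3 w).
Proof.
move=> Ww; have [sz /lexicographicP sw _ _ [mu [ymu T2 T1]]] := Ww.
have [_ e _ _ _] := (LR_crystalP n _ ymu young_lam2 young_nu2).1 T2.
rewrite /LR_pairs /S3 /= e; split=> //.
have [_ tT2] := tab_bumping sw; have /andP[sT _] := tab_shape tT2.
rewrite -e /row_shape sumn_conj_shape // -size_flatten (perm_size (perm_bumping w).2).
by rewrite size_map.
Qed.

Lemma S3K w : LR_arrays n N lam1 nu1 lam2 nu2 w -> C3 (S3 w) = w.
Proof.
move=> Ww; have [_ e _ _] := S3_arrays Ww; have [sz /lexicographicP sw _ _ _] := Ww.
by rewrite /C3 e /S3 /= -sz bumpingK.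
Qed.

Lemma size_rev_bumping k T1 T2 : size (rev_bumping k T1 T2) = k.
Proof. by elim: k T1 T2 => //= k IH T1 T2; rewrite size_rcons IH. Qed.

Lemma C3P t : LR_pairs n N lam1 nu1 lam2 nu2 t ->
  bumping (C3 t) = (t.1.2, t.2) /\ sorted lex_rel (C3 t).
Proof.
case: t => [[mu T1] T2] [/= ymu sN C1 C2].
have [tT1 e1 _ _ _] := (LR_crystalP n _ ymu young_lam1 young_nu1).1 C1.
have [tT2 e2 _ _ _] := (LR_crystalP n _ ymu young_lam2 young_nu2).1 C2.
have sh T : tab T -> row_shape T = mu -> map size T = conj_shape mu.
  by move=> tT <-; rewrite conj_shapeK // tab_shape.
apply: rev_bumpingP => //; first by rewrite !sh.
rewrite size_flatten /shape (sh T1) // sumn_conj_shape //; by case/andP: ymu.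
Qed.

Lemma C3_pairs t : LR_pairs n N lam1 nu1 lam2 nu2 t -> LR_arrays n N lam1 nu1 lam2 nu2 (C3 t).
Proof.
move=> Bt; have [e sw] := C3P Bt; case: Bt => ymu sN C1 C2.
have [_ _ _ _ c1] := (LR_crystalP n _ ymu young_lam1 young_nu1).1 C1.
have [_ e2 _ _ c2] := (LR_crystalP n _ ymu young_lam2 young_nu2).1 C2.
have [p1 p2] := perm_bumping (C3 t); rewrite e /= in p1 p2.
split.
- by rewrite /C3 size_rev_bumping.
- exact/lexicographicP.
- by move=> i i0; rewrite c1 // (permP p1) addKn.
- by move=> i i0; rewrite c2 // (permP p2) addKn.
by exists t.1.1; rewrite e.
Qed.

Lemma C3K t : LR_pairs n N lam1 nu1 lam2 nu2 t -> S3 (C3 t) = t.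
Proof.
move=> Bt; have [e _] := C3P Bt; rewrite /S3 e; case: Bt => ymu _ _ C2.
have [_ -> _ _ _] := (LR_crystalP n _ ymu young_lam2 young_nu2).1 C2.
by case: t {e ymu C2} => [[]].
Qed.

End Arrays.

Theorem theorem5p3 (n N : nat) (lam1 nu1 lam2 nu2 : seq nat)
    (young_lam1 : young lam1) (young_nu1 : young nu1)
    (young_lam2 : young lam2) (young_nu2 : young nu2)
    (rows_lam1 : size lam1 <= n) (rows_nu1 : size nu1 <= n)
    (rows_lam2 : size lam2 <= n) (rows_nu2 : size nu2 <= n)
    (sub1 : {subset diagram lam1 <= diagram nu1})
    (sub2 : {subset diagram lam2 <= diagram nu2})
    (card1 : size (skew lam1 nu1) = N) (card2 : size (skew lam2 nu2) = N) :
  let P := pictures (skew lam1 nu1) (skew lam2 nu2) in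
  let S := LR_skew_tableaux n lam1 nu1 lam2 nu2 in
  let W := LR_arrays n N lam1 nu1 lam2 nu2 in
  let B := LR_pairs n N lam1 nu1 lam2 nu2 in
  [/\ set_fun P S (S1 lam1 nu1), set_fun S W (S2 lam1 nu1) & set_fun W B S3] /\
  [/\ set_fun B W C3, set_fun W S (C2 lam1 nu1) & set_fun S P (C1 lam1 nu1 lam2)] /\
  [/\ set_bij P B (mapS lam1 nu1), set_bij B P (mapC lam1 nu1 lam2),
      forall f, P f -> mapC lam1 nu1 lam2 (mapS lam1 nu1 f) = f
    & forall t, B t -> mapS lam1 nu1 (mapC lam1 nu1 lam2 t) = t].
Proof.
move=> P S W B.
have SWP T : S T <-> W (S2 lam1 nu1 T) by apply: LR_skew_arrays.
have PS : set_fun P S (S1 lam1 nu1) by move=> f; apply: S1_pictures.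
have SW : set_fun S W (S2 lam1 nu1) by move=> T /SWP.
have WB : set_fun W B S3 by move=> w; apply: S3_arrays.
have BW : set_fun B W C3 by move=> t; apply: C3_pairs.
have WK w : W w -> S2 lam1 nu1 (C2 lam1 nu1 w) = w by apply: C2K.
have WS : set_fun W S (C2 lam1 nu1) by move=> w Ww; apply/SWP; rewrite WK.
have SP : set_fun S P (C1 lam1 nu1 lam2).
  by move=> T ST; apply: C1_pictures ST => //; rewrite card1.
have PB : set_fun P B (mapS lam1 nu1) by move=> f Pf; apply/WB/SW/PS.
have BP : set_fun B P (mapC lam1 nu1 lam2) by move=> t Bt; apply/SP/WS/BW.
have SK f : P f -> mapC lam1 nu1 lam2 (mapS lam1 nu1 f) = f.
  move=> Pf; have Wf := SW _ (PS _ Pf).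
  rewrite /mapC /mapS /= (S3K young_lam2 young_nu2 Wf) S2K.
  by apply: S1K Pf.
have CK t : B t -> mapS lam1 nu1 (mapC lam1 nu1 lam2 t) = t.
  move=> Bt; rewrite /mapC /mapS /= C1K WK; last exact: BW.
  exact: (C3K young_lam1 young_nu1 young_lam2 young_nu2 Bt).
split; [by split | split; [by split|]]; split=> //.
  exact: set_bij_can PB BP SK CK.
exact: set_bij_can BP PB CK SK.
Qed.
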